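(* Suppose that one of the following holds: (a) $R$ is a $\mathbb{Z}^n$ standard graded $k$-subalgebra of $k[x_1,\ldots,x_n]$; or (b) $R$ is a one-dimensional analytically irreducible residually rational domain whose maximal ideal has the form $\mathfrak{m}=(t^{n_1},\ldots,t^{n_e})$ for some $t\in\overline{R}$. Let $I=(a_1,\ldots,a_m)$ and $J$ be finitely generated monomial fractional ideals of $R$, where each $a_i$ is a monomial. Let $\mathbf{e}_1,\ldots,\mathbf{e}_m$ be a basis for $R^m$, viewed as a basis of $K^m$. Then there is an isomorphism of $R$-modules $$\mathrm{T}(I\otimes_R J)\;\cong\;\frac{\sum_{i<j}(a_iJ\cap a_jJ)(\mathbf{e}_i-\mathbf{e}_j)}{\sum_{i<j}(a_iR\cap a_jR)J(\mathbf{e}_i-\mathbf{e}_j)},$$ where numerator and denominator are $R$-submodules of $K^m$.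
   Context: $R$ is a commutative domain with field of fractions $K$, and $\overline{R}$ is the integral closure of $R$ in $K$. For an $R$-module $M$, $\mathrm{T}(M)=\{x\in M : rx=0\text{ for some nonzero } r\in R\}$ is its torsion submodule. A fractional ideal of $R$ is a (nonzero) finitely generated $R$-submodule of $K$. Case (a): $k$ is a field, and a $\mathbb{Z}^n$ standard graded $k$-subalgebra of $k[x_1,\ldots,x_n]$ is a $k$-subalgebra that is homogeneous for the $\mathbb{Z}^n$-grading in which $x_i$ has degree the $i$-th standard basis vector, i.e. it is spanned over $k$ by the monomials it contains. A monomial is an element $x^w=\prod x_i^{w_i}\in K$ with $w\in\mathbb{Z}^n$, and a monomial fractional ideal is one generated by monomials. Case (b): Local rings are Noetherian. A local ring is analytically irreducible if its completion is a domain. An analytically irreducible local ring is residually rational if it has the same residue field as its integral closure (which is then local; in dimension one it is a discrete valuation ring). Here a monomial is an integer power $t^z$, $z\in\mathbb{Z}$, of the fixed element $t$, and a monomial fractional ideal is one of the form $(t^{z_1},\ldots,t^{z_h})$ with $z_1,\ldots,z_h\in\mathbb{Z}$. *)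

(* Defs.v *)
From HB Require Import structures.
From mathcomp Require Import all_boot all_algebra.
From mathcomp Require Import mathcomp_extra boolp classical_sets functions.
From mathcomp.multinomials Require Import freeg mpoly.

Set Implicit Arguments.
Unset Strict Implicit.
Unset Printing Implicit Defensive.

Import GRing.Theory.
Local Open Scope classical_set_scope.
Local Open Scope ring_scope.
Local Open Scope quotient_scope.

Notation "x %:F" := (@FracField.tofrac _ x) : ring_scope.

(* Submodules are boolean predicates with a [submodClosed] structure;
   propositions are turned into booleans by excluded middle. *)

Section Span.
Variables (R : pzRingType) (V : lmodType R) (A : set V).

Definition lspan : {pred V} := fun v =>
  `[< exists (n : nat) (c : 'I_n -> R) (x : 'I_n -> V),
        (forall i, A (x i)) /\ v = \sum_i c i *: x i >].

Lemma lspan_submod_closed : submod_closed lspan.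
Proof.
split=> [|b u v /asboolP[n [c [x [xA ->]]]] /asboolP[p [d [y [yA ->]]]]].
  by apply/asboolP; exists 0%N, (fun=> 0), (fun=> 0); split=> [[]|] //; rewrite big_ord0.
apply/asboolP; exists (n + p)%N.
exists (fun i : 'I_(n + p) => match fintype.split i with inl j => b * c j | inr j => d j end).
exists (fun i : 'I_(n + p) => match fintype.split i with inl j => x j | inr j => y j end).
split=> [i|]; first by case: fintype.split.
rewrite big_split_ord scaler_sumr; congr (_ + _); apply: eq_bigr => i _.
  by rewrite (unsplitK (inl i)) scalerA.
by rewrite (unsplitK (inr i)).
Qed.

HB.instance Definition _ := GRing.isSubmodClosed.Build R V lspan lspan_submod_closed.

End Span.

Definition finitely_generated (R : pzRingType) (V : lmodType R) (M : {pred V}) :=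
  exists (n : nat) (x : 'I_n -> V), M =i lspan (range x).

Section SubmoduleType.
Variables (R : pzRingType) (V : lmodType R) (M : submodClosed V).

Definition submodule := {x : V | x \in M}.

HB.instance Definition _ := [isSub of submodule for @sval _ _].
HB.instance Definition _ := [Choice of submodule by <:].
HB.instance Definition _ := [SubChoice_isSubLmodule of submodule by <:].

End SubmoduleType.

Section QuotientModule.
Variables (R : pzRingType) (V : lmodType R) (N : submodClosed V).

Definition submod_as_zmod : {pred V} := N.

HB.instance Definition _ :=
  GRing.isZmodClosed.Build V submod_as_zmod (GRing.submod_closedB (submodClosedP N)).

Definition quotient_module := Quotient.quot submod_as_zmod.

HB.instance Definition _ := GRing.Zmodule.on quotient_module.
HB.instance Definition _ := Quotient.on quotient_module.

Definition quotient_scale (r : R) (x : quotient_module) : quotient_module :=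
  \pi_quotient_module (r *: repr x).

Lemma quotient_modP (x y : V) :
  (\pi_quotient_module x = \pi_quotient_module y) <-> (x - y \in N).
Proof.
rewrite -[x - y \in N]/(x - y \in submod_as_zmod) Quotient.idealrBE.
by split=> /eqP.
Qed.

Lemma pi_quotient_scale r x :
  quotient_scale r (\pi_quotient_module x) = \pi_quotient_module (r *: x).
Proof.
apply/quotient_modP; rewrite -scalerBr rpredZ //; apply/quotient_modP.
exact: reprK.
Qed.

Lemma pi_quotientD x y :
  \pi_quotient_module (x + y) = \pi_quotient_module x + \pi_quotient_module y.
Proof. exact: (raddfD \pi_(Quotient.quot submod_as_zmod)). Qed.

Fact quotient_scaleA r s x :
  quotient_scale r (quotient_scale s x) = quotient_scale (r * s) x.
Proof. by elim/quotW: x => x; rewrite (pi_quotient_scale s) !pi_quotient_scale scalerA. Qed.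

Fact quotient_scale1 : left_id 1 quotient_scale.
Proof. by move=> x; rewrite -[x]reprK pi_quotient_scale scale1r. Qed.

Fact quotient_scaleDr : right_distributive quotient_scale +%R.
Proof.
move=> r x y; rewrite -[x]reprK -[y]reprK.
by rewrite -pi_quotientD !pi_quotient_scale -pi_quotientD scalerDr.
Qed.

Fact quotient_scaleDl x : {morph quotient_scale^~ x : r s / r + s}.
Proof.
by move=> r s; rewrite -[x]reprK !pi_quotient_scale -pi_quotientD scalerDl.
Qed.

HB.instance Definition _ := GRing.Zmodule_isLmodule.Build R quotient_module
  quotient_scaleA quotient_scale1 quotient_scaleDr quotient_scaleDl.

End QuotientModule.

Section Subquotient.
Variables (R : pzRingType) (V : lmodType R) (M N : submodClosed V).

Definition trace_pred : {pred submodule M} := fun x => val x \in N.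

Lemma trace_submod_closed : submod_closed trace_pred.
Proof.
split=> [|r x y xN yN]; first by rewrite /trace_pred unfold_in raddf0 rpred0.
by rewrite unfold_in linearP rpredD // rpredZ.
Qed.

HB.instance Definition _ :=
  GRing.isSubmodClosed.Build R (submodule M) trace_pred trace_submod_closed.

(* M / (M :&: N), that is M / N when N is contained in M *)
Definition subquotient := quotient_module trace_pred.

HB.instance Definition _ := GRing.Lmodule.on subquotient.

End Subquotient.

Definition lmod_isomorphic (R : pzRingType) (U V : lmodType R) :=
  exists f : {linear U -> V}, bijective f.

Section Tensor.
Variables (R : comNzRingType) (M N : lmodType R).

Local Notation F := {freeg (M * N)%type / R}.
Local Notation gen x y := (<< (x, y) >> : F).

Definition tensor_relations : set F := fun z =>
  [\/ exists x x' y, z = gen (x + x') y - gen x y - gen x' y,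
      exists x y y', z = gen x (y + y') - gen x y - gen x y',
      exists r x y, z = gen (r *: x) y - r *: gen x y |
      exists r x y, z = gen x (r *: y) - r *: gen x y].

Definition tensor := quotient_module (lspan tensor_relations).

HB.instance Definition _ := GRing.Lmodule.on tensor.

End Tensor.

Section Torsion.
Variables (R : idomainType) (M : lmodType R).

Definition torsion : {pred M} := fun x =>
  `[< exists2 r : R, r != 0 & r *: x = 0 >].

Lemma torsion_submod_closed : submod_closed torsion.
Proof.
split=> [|a x y /asboolP[r r0 rx] /asboolP[s s0 sy]]; apply/asboolP.
  by exists 1; rewrite ?oner_neq0 // scaler0.
exists (r * s); first by rewrite mulf_neq0.
rewrite scalerDr -[r * s *: y]scalerA sy scaler0 addr0 scalerA.
by rewrite mulrAC -mulrA mulrC -scalerA rx scaler0.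
Qed.

HB.instance Definition _ :=
  GRing.isSubmodClosed.Build R M torsion torsion_submod_closed.

End Torsion.
Arguments torsion {R} M.

Section FractionModule.
Variable R : idomainType.
Local Notation K := {fraction R}.

Definition fraction_scale (r : R) (x : K) : K := r%:F * x.

Fact fraction_scaleA r s x :
  fraction_scale r (fraction_scale s x) = fraction_scale (r * s) x.
Proof. by rewrite /fraction_scale rmorphM mulrA. Qed.

Fact fraction_scale1 : left_id 1 fraction_scale.
Proof. by move=> x; rewrite /fraction_scale rmorph1 mul1r. Qed.

Fact fraction_scaleDr : right_distributive fraction_scale +%R.
Proof. by move=> r x y; rewrite /fraction_scale mulrDr. Qed.

Fact fraction_scaleDl x : {morph fraction_scale^~ x : r s / r + s}.
Proof. by move=> r s; rewrite /fraction_scale rmorphD mulrDl. Qed.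

HB.instance Definition _ := GRing.Zmodule_isLmodule.Build R K
  fraction_scaleA fraction_scale1 fraction_scaleDr fraction_scaleDl.

Fact fraction_scaleAl (r : R) (x y : K) : r *: (x * y) = (r *: x) * y.
Proof. exact: mulrA. Qed.

HB.instance Definition _ := GRing.Lmodule_isLalgebra.Build R K fraction_scaleAl.

End FractionModule.

(* The product of two sets of elements of an algebra, as an R-submodule; it is
   applied to ideals of R (in R^o) and to submodules of {fraction R}. *)
Definition module_product (R : pzRingType) (A : lalgType R) (M N : set A) :=
  lspan [set x * y | x in M & y in N].

HB.instance Definition _ (R : pzRingType) (A : lalgType R) (M N : set A) :=
  GRing.SubmodClosed.on (module_product M N).

Section Ideals.
Variable S : nzRingType.

Definition maximal_ideal (P : {pred S}) :=
  idealr_closed P /\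
  forall Q : {pred S}, idealr_closed Q -> {subset P <= Q} -> {subset Q <= P}.

Definition is_local_ring (P : {pred S}) :=
  maximal_ideal P /\ forall Q : {pred S}, maximal_ideal Q -> Q =i P.

Definition noetherian := forall I : submodClosed S^o, finitely_generated I.

Definition prime_chain (n : nat) :=
  exists P : 'I_n.+1 -> {pred S},
    (forall i, idealr_closed (P i) /\ prime_idealr_closed (P i)) /\
    (forall i j : 'I_n.+1, (i < j)%N ->
       {subset P i <= P j} /\ ~ {subset P j <= P i}).

Definition has_krull_dim (n : nat) := prime_chain n /\ ~ prime_chain n.+1.

End Ideals.

(* The completion of R with respect to a proper ideal mm is the inverse limit
   of the R / mm ^ i. An element of the limit is represented by a sequence u
   with u (i + 1) = u i modulo mm ^ i, two sequences being identified when
   they agree modulo mm ^ i for all i. *)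
Section Completion.
Variables (R : comNzRingType) (mm : idealr R).

Fixpoint ideal_power (i : nat) : submodClosed R^o :=
  match i with
  | 0 => lspan setT
  | i'.+1 => @module_product R R^o [set` mm] [set` ideal_power i']
  end.

Definition coherent : {pred nat -> R} := fun u =>
  `[< forall i, u i.+1 - u i \in ideal_power i >].

Lemma ideal_powerMl i (r x : R) : x \in ideal_power i -> r * x \in ideal_power i.
Proof. exact: (@rpredZ R R^o (ideal_power i) r x). Qed.

Lemma ideal_power0 i : (0 : R) \in ideal_power i.
Proof. exact: (@rpred0 R^o (ideal_power i)). Qed.

Lemma ideal_powerD i (x y : R) :
  x \in ideal_power i -> y \in ideal_power i -> x + y \in ideal_power i.
Proof. exact: (@rpredD R^o (ideal_power i) x y). Qed.

Lemma coherent_subring_closed : subring_closed coherent.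
Proof.
split=> [|u v /asboolP uP /asboolP vP|u v /asboolP uP /asboolP vP];
  apply/asboolP => i.
- by rewrite subrr ideal_power0.
- have -> : (u - v) i.+1 - (u - v) i =
            (u i.+1 - u i) + (-1) * (v i.+1 - v i).
    rewrite -[(u - v) i.+1]/(u i.+1 - v i.+1) -[(u - v) i]/(u i - v i).
    by rewrite mulN1r !opprD !opprK addrACA.
  by rewrite ideal_powerD // ideal_powerMl.
- have -> : (u * v) i.+1 - (u * v) i =
            u i.+1 * (v i.+1 - v i) + v i * (u i.+1 - u i).
    rewrite -[(u * v) i.+1]/(u i.+1 * v i.+1) -[(u * v) i]/(u i * v i).
    by rewrite !mulrBr [v i * u i.+1]mulrC [v i * u i]mulrC addrA addrNK.
  by rewrite ideal_powerD // ideal_powerMl.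
Qed.

HB.instance Definition _ :=
  GRing.isSubringClosed.Build (nat -> R) coherent coherent_subring_closed.

Definition coherent_seq := {u : nat -> R | u \in coherent}.

HB.instance Definition _ := [isSub of coherent_seq for @sval _ _].
HB.instance Definition _ := [Choice of coherent_seq by <:].
HB.instance Definition _ := [SubChoice_isSubComNzRing of coherent_seq by <:].

Definition null_seq : {pred coherent_seq} := fun u =>
  `[< forall i, val u i \in ideal_power i >].

Lemma null_seq_idealr_closed : idealr_closed null_seq.
Proof.
split=> [||a u v /asboolP uP /asboolP vP].
- by apply/asboolP => i; rewrite raddf0 ideal_power0.
- apply/negP => /asboolP/(_ 1%N)/asboolP[n [c [x [xP e]]]].
  have : (1 : R) \in mm.
    rewrite (_ : 1 = \sum_(i < n) c i * x i) ?rpred_sum // => i _.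
    by have [y ym [z _ <-]] := xP i; rewrite idealMr // mulrC idealMr.
  by rewrite idealr1.
- by apply/asboolP => i; apply: (ideal_powerD (ideal_powerMl _ (uP i)) (vP i)).
Qed.

HB.instance Definition _ := isIdealr.Build coherent_seq null_seq null_seq_idealr_closed.

Definition completion := {ideal_quot null_seq}.

HB.instance Definition _ := GRing.ComNzRing.on completion.

Definition analytically_irreducible := GRing.integral_domain_axiom completion.

End Completion.

Section IntegralClosure.
Variable R : idomainType.

Definition integral_pred : {pred {fraction R}} := fun x =>
  `[< integralOver (@FracField.tofrac R) x >].

Lemma integral_subring_closed : subring_closed integral_pred.
Proof.
split=> [|x y /asboolP xP /asboolP yP|x y /asboolP xP /asboolP yP]; apply/asboolP.
- exact: integral1.
- exact: integral_sub.
- exact: integral_mul.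
Qed.

HB.instance Definition _ :=
  GRing.isSubringClosed.Build {fraction R} integral_pred integral_subring_closed.

Definition integral_closure := {x : {fraction R} | x \in integral_pred}.

HB.instance Definition _ := [isSub of integral_closure for @sval _ _].
HB.instance Definition _ := [Choice of integral_closure by <:].
HB.instance Definition _ := [SubChoice_isSubComNzRing of integral_closure by <:].

Definition to_integral_closure (r : R) : integral_closure :=
  exist _ r%:F (asboolT (integral_id (@FracField.tofrac R) r)).

(* The natural map from R / mm to the residue field of the integral closure is
   well defined and injective (first clause), and surjective (second clause). *)
Definition residually_rational (mm : {pred R}) :=
  exists nn : {pred integral_closure},
    [/\ is_local_ring nn,
        (forall r : R, (to_integral_closure r \in nn) = (r \in mm)) &
        (forall x, exists r : R, x - to_integral_closure r \in nn)].

End IntegralClosure.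

Definition fractional_ideal (R : idomainType) (I : {pred {fraction R}}) :=
  finitely_generated I /\ exists2 x, x \in I & x != 0.

(* [mon] is the set of monomials of {fraction R}. *)
Definition monomial_fractional_ideal (R : idomainType) (mon : set {fraction R})
    (I : {pred {fraction R}}) :=
  fractional_ideal I /\
  exists (h : nat) (b : 'I_h -> {fraction R}),
    (forall j, mon (b j)) /\ I =i lspan (range b).

Section GradedCase.
Variables (R : idomainType) (k : fieldType) (n : nat).
Variable phi : {rmorphism R -> {mpoly k[n]}}.

(* phi identifies R with a k-subalgebra of k[x_1, ..., x_n] that is spanned by
   the monomials it contains. *)
Definition graded_subalgebra :=
  [/\ injective phi,
      (forall c : k, range phi c%:MP) &
      (forall r, phi r \in lspan [set p | range phi p /\ exists w, p = 'X_[w]])].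

(* the x in {fraction R} whose image in the fraction field of k[x_1, ..., x_n]
   is x_1 ^ w_1 * ... * x_n ^ w_n for some integers w_i *)
Definition graded_monomials : set {fraction R} := fun x =>
  exists (w : 'I_n -> int) (r s : R),
    [/\ s != 0, x = r%:F / s%:F &
        (phi r)%:F / (phi s)%:F = \prod_i ('X_i : {mpoly k[n]})%:F ^ w i].

End GradedCase.

Definition graded_case (R : idomainType) (mon : set {fraction R}) :=
  exists (k : fieldType) (n : nat) (phi : {rmorphism R -> {mpoly k[n]}}),
    graded_subalgebra phi /\ mon = graded_monomials phi.

Definition local_case (R : idomainType) (mon : set {fraction R}) :=
  exists mm : idealr R,
    [/\ is_local_ring mm, noetherian R, has_krull_dim R 1,
        analytically_irreducible mm & residually_rational mm] /\
  exists (t : {fraction R}) (e : nat) (z : 'I_e -> nat),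
    [/\ integralOver (@FracField.tofrac R) t,
        [set r%:F | r in [set` mm]] = [set` lspan (range (fun i => t ^+ z i))] &
        mon = range (fun j : int => t ^ j)].

Definition module_basis (R : pzRingType) (V : lmodType R) (m : nat) (e : 'I_m -> V) :=
  forall v, exists! c : {ffun 'I_m -> R}, v = \sum_i c i *: e i.

Section Presentation.
Variables (R : idomainType) (m : nat).
Local Notation K := {fraction R}.
Variables (a : 'I_m -> K) (J : {pred K}) (e : 'I_m -> {ffun 'I_m -> R^o}).

(* c (e_i - e_j) in K ^ m *)
Definition scaled_diff (c : K) (i j : 'I_m) : {ffun 'I_m -> K} :=
  [ffun l => c * (@FracField.tofrac R (e i l) - @FracField.tofrac R (e j l))].

Definition numerator :=
  lspan [set v | exists (i j : 'I_m) (c : K),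
    [/\ (i < j)%N,
        ([set a i * y | y in [set` J]] `&` [set a j * y | y in [set` J]]) c &
        v = scaled_diff c i j]].

Definition denominator :=
  lspan [set v | exists (i j : 'I_m) (c : K),
    [/\ (i < j)%N,
        c \in module_product
          ([set a i * r%:F | r in [set: R]] `&` [set a j * r%:F | r in [set: R]])
          [set` J] &
        v = scaled_diff c i j]].

HB.instance Definition _ := GRing.SubmodClosed.on numerator.
HB.instance Definition _ := GRing.SubmodClosed.on denominator.

End Presentation.

(* Main.v *)
Require Import Defs.
From HB Require Import structures.
From mathcomp Require Import all_boot all_algebra.
From mathcomp Require Import boolp classical_sets.
From mathcomp Require Import zify.
From mathcomp.multinomials Require Import freeg mpoly.
Set Implicit Arguments.
Unset Strict Implicit.
Unset Printing Implicit Defensive.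
Import GRing.Theory.
Local Open Scope classical_set_scope.
Local Open Scope ring_scope.
Local Open Scope quotient_scope.

(** Map R^m onto I by sending the i-th basis vector to a_i, with kernel the
    syzygies of the a_i, and tensor with J.  Writing w_i = a_i y_i, an element
    of I (x) J is a sum of the a_i (x) y_i, hence is given by a family w with
    w_i in a_i J, and it is torsion exactly when its image sum_i w_i in the
    torsion free module IJ vanishes.  It is zero exactly when w is a
    combination of the products of a syzygy with an element of J.  So the
    torsion of I (x) J is the quotient of the families with sum zero in the
    a_i J by J times the families with sum zero in the a_i R.

    It remains to see that families with sum zero are generated by the obvious
    ones, c in the place i and -c in the place j with c in the intersection of
    the i-th and j-th modules.  This is exactness at the middle of
      sum_(i < j) (L_i meet L_j) -> sum_i L_i -> K,
    called [exact_at L] below.  It is needed for L_i = a_i J (numerator) and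
    L_i = a_i R (denominator).  Monomials enter in proving it for families of
    monomial fractional ideals.

    - In the graded case the L_i are spanned over k by monomials and distinct
      monomials are independent ([graded_independent]), so a relation with
      sum zero splits into relations that involve a single monomial; such a
      relation is carried by the intersection of the modules that contain it.
    - In the local case there is no grading, only the filtration of K by the
      t^n Rbar.  The crucial point ([mem_tail]) is that an element of L_i in
      t^n Rbar is a combination of the t^p in L_i with p >= n: a coefficient
      whose leading term cancels lies in the maximal ideal, which is itself
      generated by powers of t.  Hence the leading terms of a relation can be
      cancelled by a relation on a single power of t ([descent_step]), and the
      relation is pushed arbitrarily deep in the filtration.  Deep elements of
      L_i lie in all of the other L_j ([deep_divisible], which uses that in
      dimension one every nonzero ideal contains a power of each t^(n_i)), and
      then nothing is left to prove.

    Both cases are summarized by [exact_monomials], and [torsion_presentation]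
    is the tensor product computation of the first paragraph. *)

(** * Spans, submodules and fractions *)

Section SpanTheory.
Variables (R : pzRingType) (V : lmodType R).
Implicit Type A : set V.

Lemma mem_lspan A x : A x -> x \in lspan A.
Proof.
move=> Ax; apply/asboolP; exists 1%N, (fun=> 1), (fun=> x).
by rewrite big_ord1 scale1r.
Qed.

Lemma lspan_ind A (P : V -> Prop) :
  P 0 -> (forall r x y, A x -> P y -> P (r *: x + y)) ->
  forall v, v \in lspan A -> P v.
Proof.
move=> P0 PD v /asboolP[n [c [x [xA ->]]]].
elim: n c x xA => [|n IHn] c x xA; first by rewrite big_ord0.
by rewrite big_ord_recl; apply/PD/IHn.
Qed.

Lemma lspan_sub A (M : submodClosed V) :
  (forall x, A x -> x \in M) -> {subset lspan A <= M}.
Proof.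
move=> AM; apply: lspan_ind => [|r x y Ax yM]; first exact: rpred0.
by rewrite rpredD // rpredZ // AM.
Qed.

(** A span of a finite family needs only one coefficient for each member,
    although repeated generators are allowed in the definition of [lspan]. *)
Lemma lspan_rangeP (m : nat) (b : 'I_m -> V) v :
  v \in lspan (range b) -> exists c : 'I_m -> R, v = \sum_i c i *: b i.
Proof.
move: v; apply: lspan_ind => [|r _ _ [i _ <-] [c ->]].
  by exists (fun=> 0); rewrite big1 // => i _; rewrite scale0r.
exists (fun j => (if j == i then r else 0) + c j).
under [RHS]eq_bigr do rewrite scalerDl.
rewrite big_split /=; congr (_ + _); rewrite (bigD1 i) //= eqxx big1 ?addr0 //.
by move=> j /negPf->; rewrite scale0r.
Qed.

End SpanTheory.

Lemma submodN (R : pzRingType) (V : lmodType R) (M : submodClosed V) x :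
  x \in M -> - x \in M.
Proof. by move=> xM; rewrite -scaleN1r rpredZ. Qed.

Lemma submodB (R : pzRingType) (V : lmodType R) (M : submodClosed V) x y :
  x \in M -> y \in M -> x - y \in M.
Proof. by move=> xM yM; rewrite rpredD // submodN. Qed.

Section SubmoduleVal.
Variables (R : pzRingType) (V : lmodType R) (M : submodClosed V).
Implicit Type x : submodule M.

Lemma val_submodD x y : val (x + y) = val x + val y.
Proof. exact: (raddfD val). Qed.

Lemma val_submodZ r x : val (r *: x) = r *: val x.
Proof. by rewrite linearZ. Qed.

Lemma val_submod_sum (T : Type) (s : seq T) (x : T -> submodule M) :
  val (\sum_(t <- s) x t) = \sum_(t <- s) val (x t).
Proof. exact: (raddf_sum val). Qed.

End SubmoduleVal.

Lemma lspan_linear (R : pzRingType) (U V : lmodType R) (f : {linear U -> V})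
    (A : set U) (M : submodClosed V) :
  (forall x, A x -> f x \in M) -> forall u, u \in lspan A -> f u \in M.
Proof.
move=> AM; apply: lspan_ind => [|r x y Ax yM]; first by rewrite linear0 rpred0.
by rewrite linearP rpredD // rpredZ // AM.
Qed.

Section Fractions.
Variable R : idomainType.
Local Notation K := {fraction R}.

Lemma scale_fracE (r : R) (x : K) : r *: x = r%:F * x.
Proof. by []. Qed.

Lemma integral_frac (r : R) : r%:F \in integral_pred (R := R).
Proof. by apply/asboolP; exact: integral_id. Qed.

Lemma fractionP (x : K) : exists r s : R, s != 0 /\ x = r%:F / s%:F.
Proof.
elim/quotW: x => f; exists (\n_f), (\d_f); split; first exact: denom_ratioP.
apply: (mulIf (_ : (\d_f)%:F != 0)); first by rewrite tofrac_eq0 denom_ratioP.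
rewrite divfK ?tofrac_eq0 ?denom_ratioP //; unlock FracField.tofrac.
rewrite -[LHS](FracField.pi_mul f); apply/eqmodP.
rewrite /= FracField.equivfE /FracField.mulf /=.
by rewrite !numden_Ratio ?(oner_eq0, mulf_neq0, denom_ratioP) // !mulr1 mulrC.
Qed.

(** The common denominator of the finitely many fractions x u / y u. *)
Lemma exists_multiplier (T : finType) (x y : T -> K) : (forall u, y u != 0) ->
  exists2 b : R, b != 0 & forall u, exists r : R, b%:F * x u = r%:F * y u.
Proof.
move=> y0.
have /choice[s sP] u : exists s : R, s != 0 /\ exists r : R, s%:F * x u = r%:F * y u.
  have [r [s [s0 xy]]] := fractionP (x u / y u); exists s; split=> //; exists r.
  apply: (mulIf (_ : (y u)^-1 != 0)); first by rewrite invr_eq0.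
  by rewrite mulfK // -mulrA xy mulrC divfK // tofrac_eq0.
exists (\prod_u s u) => [|u]; first by apply/prodf_neq0 => u _; case: (sP u).
have [_ [r sr]] := sP u; exists (\prod_(v | v != u) s v * r).
by rewrite (bigD1 u) //= !rmorphM mulrAC sr [LHS]mulrC mulrA.
Qed.

End Fractions.

(** * Relations with sum zero in a family of submodules *)

Section Exactness.
Variables (R : idomainType) (m : nat).
Local Notation K := {fraction R}.
Implicit Types (L : 'I_m -> submodClosed K) (w : 'I_m -> K).

(** Indexing by all pairs (i, j) instead of i < j makes the sums symmetric, at
    the cost of a redundant choice of c. *)
Definition boundary L w := exists c : 'I_m -> 'I_m -> K,
  (forall i j, (c i j \in L i) /\ (c i j \in L j)) /\
  forall i, w i = \sum_j (c i j - c j i).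

(** Exactness at the middle of the complex formed by the pairwise
    intersections, the direct sum of the L i, and K. *)
Definition exact_at L :=
  forall w, (forall i, w i \in L i) -> \sum_i w i = 0 -> boundary L w.

(** If all the entries lie in a single L l, the relation with sum zero is the
    sum over i of the elementary relations with w i in place i and - w i in
    place l.  Both cases reduce to relations of this kind. *)
Lemma boundary_star L w l : (forall i, (w i \in L i) /\ (w i \in L l)) ->
  \sum_i w i = 0 -> boundary L w.
Proof.
move=> wL w0; exists (fun i j => if j == l then w i else 0); split=> [i j|i].
  by case: eqP => [->|_]; [exact: wL|rewrite !rpred0].
rewrite sumrB -big_mkcond big_pred1_eq; case: eqP => _; last by rewrite big1 ?subr0.
by rewrite w0 subr0.
Qed.

Lemma boundary0 L : boundary L (fun=> 0).
Proof. by exists (fun _ _ => 0); split=> [i j|i]; rewrite ?rpred0 // big1 ?subrr. Qed.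

Lemma boundaryD L w1 w2 : boundary L w1 -> boundary L w2 ->
  boundary L (fun i => w1 i + w2 i).
Proof.
move=> [c [cL cw]] [d [dL dw]]; exists (fun i j => c i j + d i j); split=> [i j|i].
  by have [[? ?] [? ?]] := (cL i j, dL i j); split; apply: rpredD.
by rewrite cw dw -big_split; apply: eq_bigr => j _; rewrite opprD addrACA.
Qed.

Lemma boundary_sum (T : Type) (r : seq T) L (w : T -> 'I_m -> K) :
  (forall t, boundary L (w t)) -> boundary L (fun i => \sum_(t <- r) w t i).
Proof.
move=> wb; elim: r => [|t r IHr].
  rewrite (_ : (fun _ => _) = fun=> 0); first exact: boundary0.
  by apply/funext => i; rewrite big_nil.
rewrite (_ : (fun _ => _) = fun i => w t i + \sum_(u <- r) w u i).
  exact: boundaryD.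
by apply/funext => i; rewrite big_cons.
Qed.

End Exactness.

(** All that the computation of the torsion uses about the monomials.  Closure
    under products makes a i * J a monomial fractional ideal when J is. *)
Definition exact_monomials (R : idomainType) (mon : set {fraction R}) :=
  [/\ forall x, mon x -> x != 0,
      forall x y, mon x -> mon y -> mon (x * y) &
      forall m (L : 'I_m -> submodClosed {fraction R}),
        (forall i, monomial_fractional_ideal mon (L i)) -> exact_at L].

(** * The graded case *)

Section GradedCase.
Variables (R : idomainType) (k : fieldType) (n : nat).
Variable phi : {rmorphism R -> {mpoly k[n]}}.
Local Notation K := {fraction R}.
Hypothesis phi_graded : graded_subalgebra phi.
Local Notation mon := (graded_monomials phi).
Local Notation const := (fun c : R => exists a : k, phi c = a%:MP).

Lemma graded_phi_inj : injective phi.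
Proof. by case: phi_graded. Qed.

Lemma mpolyX_neq0 (m : 'X_{1..n}) : 'X_[m] != 0 :> {mpoly k[n]}.
Proof.
apply/eqP => /(congr1 (mcoeff m)) /eqP.
by rewrite mcoeffX eqxx mcoeff0 oner_eq0.
Qed.

Lemma graded_monomialZ p (m : 'X_{1..n}) x : phi p = 'X_[m] -> mon x -> mon (p *: x).
Proof.
move=> pE [w [r [s [s0 -> wE]]]].
exists (fun i => (m i)%:Z + w i), (p * r), s; split=> //.
  by rewrite scale_fracE mulrA rmorphM.
rewrite !rmorphM -mulrA wE pE mpolyXE_id rmorph_prod -big_split /=.
apply: eq_bigr => i _; rewrite rmorphXn /= expfzDr //.
by rewrite tofrac_eq0 mpolyX_neq0.
Qed.

(** A monomial fractional ideal is homogeneous: expanding the coefficients of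
    an element over k moves their monomials into the generators. *)
Lemma graded_decomposition (M : {pred K}) (h : nat) (b : 'I_h -> K) :
    (forall j, mon (b j)) -> M =i lspan (range b) ->
  forall x, x \in M -> exists (N : nat) (c : 'I_N -> R) (mu : 'I_N -> K),
    [/\ forall u, const (c u), forall u, mon (mu u) /\ mu u \in M &
        x = \sum_u c u *: mu u].
Proof.
move=> bmon ME.
suff main x : x \in lspan (range b) -> exists s : seq (R * K),
    (forall u, u \in s -> [/\ const u.1, mon u.2 & u.2 \in M]) /\
    x = \sum_(u <- s) u.1 *: u.2.
  move=> x; rewrite ME => /main[s [sP ->]].
  exists (size s), (fun u => (nth 0 s u).1), (fun u => (nth 0 s u).2).
  split=> [u|u|]; last by rewrite (big_nth 0) big_mkord.
    by case: (sP _ (mem_nth 0 (ltn_ord u))).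
  by case: (sP _ (mem_nth 0 (ltn_ord u))).
move: x; apply: lspan_ind => [|r _ y [j _ <-] [s [sP ->]]].
  by exists [::]; rewrite big_nil.
have [_ Ck /(_ r)/asboolP[N [c [q [qP rE]]]]] := phi_graded.
have /choice[p pP] u : exists p : R, phi p = q u by have [[p _ <-] _] := qP u; exists p.
have /choice[d dP] u : exists d : R, phi d = (c u)%:MP by have [d _ <-] := Ck (c u); exists d.
have rE' : r = \sum_u d u * p u.
  apply: graded_phi_inj; rewrite rE rmorph_sum; apply: eq_bigr => u _.
  by rewrite rmorphM /= dP pP mul_mpolyC.
exists ([seq (d u, p u *: b j) | u <- enum 'I_N] ++ s); split=> [u|].
  rewrite mem_cat => /orP[/mapP[v _ ->]|/sP//]; split=> /=.
  - by exists (c v).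
  - by have [_ [w pw]] := qP v; apply: (graded_monomialZ (m := w)); rewrite ?pP.
  - by rewrite ME rpredZ // mem_lspan //; exists j.
rewrite big_cat big_map big_enum /= rE' scaler_suml; congr (_ + _).
by apply: eq_bigr => u _; rewrite scalerA.
Qed.

(** Distinct Laurent monomials are linearly independent over k.  A common
    denominator b in R and the shift by the monomial XD with exponent D in each
    variable turn them into genuine monomials of k[x_1, ..., x_n], where the
    coefficient of a given monomial can be extracted. *)
Lemma graded_independent (T : finType) (c : T -> R) (mu : T -> K) (v : T) :
    (forall u, const (c u)) -> (forall u, mon (mu u)) ->
    \sum_u c u *: mu u = 0 ->
  \sum_(u | mu u == mu v) c u *: mu u = 0.
Proof.
move=> /choice[a aE] /choice[w /choice[p /choice[q wP]]] sum0.
pose D := (\sum_u \sum_i absz (w u i))%N.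
pose e u := [multinom absz (w u i + D%:Z)%R | i < n].
have eE u i : (e u i)%:Z = (w u i + D%:Z)%R :> int.
  rewrite mnmE; suff : (absz (w u i) <= D)%N by lia.
  by rewrite /D (bigD1 u) //= (bigD1 i) //=; lia.
(* b need not be a monomial, it is cancelled at the end. *)
have [b b0 bP] := exists_multiplier mu (fun _ : T => oner_neq0 K).
have {bP} /choice[r rE] u : exists r : R, b%:F * mu u = r%:F.
  by have [r ->] := bP u; exists r; rewrite mulr1.
have Xneq0 i : ('X_i : {mpoly k[n]})%:F != 0 by rewrite tofrac_eq0 mpolyX_neq0.
pose XD : {mpoly k[n]} := \prod_(i < n) 'X_i ^+ D.
have rX u : phi (r u) * XD = phi b * 'X_[e u].
  have [q0 muE pq] := wP u.
  have phiq0 : (phi (q u))%:F != 0.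
    by rewrite tofrac_eq0 -(rmorph0 phi) (inj_eq graded_phi_inj).
  apply/eqP; rewrite -tofrac_eq !tofracM; apply/eqP.
  have -> : (phi (r u))%:F = (phi b)%:F * ((phi (p u))%:F / (phi (q u))%:F).
    apply: (mulIf phiq0); rewrite -mulrA divfK // -!tofracM -!rmorphM; congr (phi _)%:F.
    apply/eqP; rewrite -tofrac_eq !tofracM -rE muE -mulrA divfK //.
    by rewrite tofrac_eq0.
  rewrite pq -mulrA; congr (_ * _); rewrite mpolyXE_id !rmorph_prod -big_split /=.
  apply: eq_bigr => i _; rewrite !rmorphXn /=.
  by rewrite [RHS]exprnP eE [RHS](expfzDr _ _ (Xneq0 i)).
have b0' : phi b != 0 by rewrite -(rmorph0 phi) (inj_eq graded_phi_inj).
have XD0 : XD != 0.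
  by apply/prodf_neq0 => i _; rewrite expf_neq0 // mpolyX_neq0.
have muE u : (mu u == mu v) = (e u == e v).
  have bF0 : b%:F != 0 by rewrite tofrac_eq0.
  apply/eqP/eqP => [muv|euv].
    have ruv : r u = r v by apply/eqP; rewrite -tofrac_eq -!rE muv.
    have /(mulfI b0') Xuv : phi b * 'X_[e u] = phi b * 'X_[e v] by rewrite -!rX ruv.
    have := mcoeffX k (e u) (e v); rewrite Xuv mcoeffX eqxx.
    by case: (eqVneq (e u) (e v)) => [//|_ /eqP]; rewrite oner_eq0.
  apply: (mulfI bF0); rewrite !rE; congr (_%:F); apply: graded_phi_inj.
  by apply: (mulIf XD0); rewrite !rX euv.
have sumX : \sum_u a u *: 'X_[e u] = 0 :> {mpoly k[n]}.
  apply: (mulfI b0'); rewrite mulr0 mulr_sumr.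
  transitivity (phi (\sum_u c u * r u) * XD).
    rewrite rmorph_sum mulr_suml; apply: eq_bigr => u _.
    by rewrite rmorphM -mulrA rX aE -mul_mpolyC mulrCA.
  suff -> : \sum_u c u * r u = 0 by rewrite rmorph0 mul0r.
  apply/eqP; rewrite -tofrac_eq0 rmorph_sum; apply/eqP.
  transitivity (b%:F * \sum_u c u *: mu u); last by rewrite sum0 mulr0.
  rewrite mulr_sumr; apply: eq_bigr => u _.
  by rewrite /= tofracM -rE scale_fracE mulrCA.
have suma : \sum_(u | mu u == mu v) a u = 0.
  have := congr1 (mcoeff (e v)) sumX; rewrite mcoeff0 raddf_sum /= => E.
  rewrite -[RHS]E big_mkcond; apply: eq_bigr => u _; rewrite mcoeffZ mcoeffX muE.
  by case: eqP; rewrite ?mulr1 ?mulr0.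
rewrite (eq_bigr (fun u => c u *: mu v)) => [|u /eqP-> //].
rewrite -scaler_suml (_ : \sum_(u | _) c u = 0) ?scale0r //.
apply: graded_phi_inj; rewrite rmorph0 rmorph_sum (eq_bigr _ (fun u _ => aE u)).
transitivity ((\sum_(u | mu u == mu v) a u)%:MP : {mpoly k[n]}).
  by rewrite raddf_sum.
by rewrite suma mpolyC0.
Qed.

Lemma graded_monomial_neq0 x : mon x -> x != 0.
Proof.
move=> [w [r [s [s0 -> rs]]]]; rewrite mulf_neq0 ?invr_eq0 ?tofrac_eq0 //.
apply/eqP => r0; move/eqP: rs; rewrite r0 rmorph0 tofrac0 mul0r eq_sym; apply/negP.
by apply/prodf_neq0 => i _; rewrite expfz_neq0 // tofrac_eq0 mpolyX_neq0.
Qed.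

Lemma graded_monomialM x y : mon x -> mon y -> mon (x * y).
Proof.
move=> [w [r [s [s0 -> wE]]]] [w' [r' [s' [s'0 -> wE']]]].
exists (fun i => w i + w' i), (r * r'), (s * s'); split.
- by rewrite mulf_neq0.
- by rewrite !tofracM invfM mulrACA.
rewrite !rmorphM invfM mulrACA wE wE' -big_split /=.
by apply: eq_bigr => i _; rewrite expfzDr // tofrac_eq0 mpolyX_neq0.
Qed.

Lemma graded_exact_monomials : exact_monomials mon.
Proof.
split=> [|x y|m L Lmon w wL w0].
- exact: graded_monomial_neq0.
- exact: graded_monomialM.
have /choice[D DP] i : exists D : {N & 'I_N -> R * K},
    [/\ forall u, const (tagged D u).1,
        forall u, mon (tagged D u).2 /\ (tagged D u).2 \in L i &
        w i = \sum_u (tagged D u).1 *: (tagged D u).2].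
  have [_ [h [b [bmon LE]]]] := Lmon i.
  have [N [c [mu [cP muP wE]]]] := graded_decomposition bmon LE (wL i).
  by exists (Tagged (fun N => 'I_N -> R * K) (fun u => (c u, mu u))).
pose T := {i : 'I_m & 'I_(tag (D i))}.
pose c (u : T) : R := (tagged (D (tag u)) (tagged u)).1.
pose mu (u : T) : K := (tagged (D (tag u)) (tagged u)).2.
have cP u : const (c u) by case: (DP (tag u)) => /(_ (tagged u)).
have muP u : mon (mu u) by case: (DP (tag u)) => _ /(_ (tagged u))[].
have muL u : mu u \in L (tag u) by case: (DP (tag u)) => _ /(_ (tagged u))[].
have wE i : w i = \sum_(u | tag u == i) c u *: mu u.
  pose F j (u : 'I_(tag (D j))) : K := (tagged (D j) u).1 *: (tagged (D j) u).2.
  transitivity (\sum_(j | j == i) \sum_(u < tag (D j)) F j u).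
    by rewrite big_pred1_eq; case: (DP i).
  by rewrite (sig_big_dep _ (fun _ _ => true)); apply: eq_bigl => u; rewrite andbT.
have sum0 : \sum_u c u *: mu u = 0.
  rewrite (partition_big tag xpredT) //= -[RHS]w0.
  by apply: eq_bigr => i _; rewrite wE.
(* Group the terms by their monomial, with one index chosen in each group. *)
pose rep u := odflt u [pick v | mu v == mu u].
have mu_rep u : mu (rep u) = mu u.
  by rewrite /rep; case: pickP => [v /eqP//|].
have rep_eq u v : (rep u == rep v) = (mu u == mu v).
  apply/eqP/eqP => [uv|uv]; first by rewrite -mu_rep uv mu_rep.
  by rewrite /rep uv; case: pickP => // /(_ v); rewrite eqxx.
have -> : w = fun i => \sum_(v : T) \sum_(u | (tag u == i) && (rep u == v)) c u *: mu u.
  by apply/funext => i; rewrite wE (partition_big rep xpredT).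
apply: boundary_sum => v; apply: (@boundary_star _ _ _ _ (tag v)) => [i|].
  split; apply: rpred_sum => u /andP[/eqP ui /eqP uv]; apply: rpredZ.
    by rewrite -ui.
  by rewrite -mu_rep uv.
transitivity (\sum_(u | rep u == v) c u *: mu u).
  rewrite [RHS](partition_big tag xpredT) //=.
  by apply: eq_bigr => i _; apply: eq_bigl => u; rewrite andbC.
have [u0 /eqP <-|none] := pickP (fun u => rep u == v); last by rewrite big_pred0.
by rewrite (eq_bigl _ _ (rep_eq^~ u0)); exact: graded_independent.
Qed.

End GradedCase.

(** * Prime ideals in local rings *)

Section Ideals.
Variable S : comNzRingType.
Implicit Types (I P Q : {pred S}) (g : S).

Lemma idealr_closedM I (a x : S) : idealr_closed I -> x \in I -> a * x \in I.
Proof. by case=> I0 _ IM xI; rewrite -[a * x]addr0 IM. Qed.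

Lemma idealr_closedD I (x y : S) :
  idealr_closed I -> x \in I -> y \in I -> x + y \in I.
Proof. by case=> _ _ IM xI yI; rewrite -[x]mul1r IM. Qed.

(** This is I + S u. *)
Definition ideal_adjoin I (u : S) : {pred S} :=
  fun x => `[< exists p a, p \in I /\ x = p + a * u >].

Lemma ideal_adjoin_closed I (u : S) : idealr_closed I ->
  1 \notin ideal_adjoin I u -> idealr_closed (ideal_adjoin I u).
Proof.
move=> Iid I1; split=> // [|a x y /asboolP[p [b [pI ->]]] /asboolP[q [c [qI ->]]]].
  by apply/asboolP; exists 0, 0; case: Iid => I0; rewrite mul0r addr0.
apply/asboolP; exists (a * p + q), (a * b + c); case: Iid => _ _ ->//; split=> //.
by rewrite mulrDr mulrDl mulrA addrACA.
Qed.

Lemma sub_ideal_adjoin I (u : S) : {subset I <= ideal_adjoin I u}.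
Proof. by move=> x xI; apply/asboolP; exists x, 0; rewrite mul0r addr0. Qed.

Lemma mem_ideal_adjoin I (u : S) : idealr_closed I -> u \in ideal_adjoin I u.
Proof. by case=> I0 _ _; apply/asboolP; exists 0, 1; rewrite mul1r add0r. Qed.

(** Among the ideals that contain I and avoid the powers of g, Zorn's lemma
    gives a maximal one.  It is prime: if u and v are outside, the ideals
    generated by it together with u and with v contain powers of g, hence so
    does the one generated together with u v.  The case g = 1 provides maximal
    ideals. *)
Lemma exists_prime_avoiding I g :
    idealr_closed I -> (forall k, g ^+ k \notin I) ->
  exists P, [/\ idealr_closed P, prime_idealr_closed P, {subset I <= P},
    (forall k, g ^+ k \notin P) &
    forall Q, idealr_closed Q -> {subset P <= Q} -> (forall k, g ^+ k \notin Q) ->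
      {subset Q <= P}].
Proof.
move=> Iid gI.
(* Zorn's lemma is applied to sets that become good ideals after adding I:
   in this way the union of the empty chain is a good set as well. *)
pose join (A : set S) : {pred S} := fun x => `[< x \in I \/ A x >].
pose good A := idealr_closed (join A) /\ forall k, g ^+ k \notin join A.
have [F Fgood Ftot|A [[Aid gA] Amax]] := @Zorn_bigcup S good.
  have sub x y : x \in join (\bigcup_(X in F) X) -> y \in join (\bigcup_(X in F) X) ->
      (x \in I /\ y \in I) \/ exists2 X, F X & x \in join X /\ y \in join X.
    move=> /asboolP[xI|[X FX Xx]] /asboolP[yI|[Y FY Yy]].
    - by left.
    - by right; exists Y => //; split; apply/asboolP; [left|right].
    - by right; exists X => //; split; apply/asboolP; [right|left].
    - case: (Ftot _ _ FX FY) => [XY|YX]; right; [exists Y|exists X] => //;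
        split; apply/asboolP; right=> //; by [apply: XY|apply: YX].
  have mono X x : F X -> x \in join X -> x \in join (\bigcup_(X in F) X).
    by move=> FX /asboolP[xI|Xx]; apply/asboolP; [left|right; exists X].
  have gU k : g ^+ k \notin join (\bigcup_(X in F) X).
    apply/negP => gk; have [[/(negP (gI k))//]|[X FX [gX _]]] := sub _ _ gk gk.
    by case: (Fgood X FX) => _ /(_ k)/negP.
  split=> //; split; first by apply/asboolP; left; case: Iid.
    exact: (gU 0%N).
  move=> a x y xU yU; have [[xI yI]|[X FX [xX yX]]] := sub _ _ xU yU.
    by apply/asboolP; left; case: Iid => _ _ ->.
  by apply: (mono X) => //; case: (Fgood X FX) => -[_ _ ->].
have IA : {subset I <= join A} by move=> x xI; apply/asboolP; left.
have max Q : idealr_closed Q -> {subset join A <= Q} -> (forall k, g ^+ k \notin Q) ->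
    {subset Q <= join A}.
  move=> Qid AQ gQ; apply: contrapT => QA.
  have jQ : join [set` Q] =i Q.
    move=> x; apply/asboolP/idP => [[xI|//]|xQ]; last by right.
    exact/AQ/IA.
  apply: (Amax [set` Q]).
    split=> [x Ax|QA']; first by apply: AQ; apply/asboolP; right.
    by apply: QA => x xQ; apply/asboolP; right; apply: QA'.
  split=> [|k]; last by rewrite jQ.
  case: Qid => Q0 Q1 QM; split=> [||a x y]; rewrite ?jQ //.
  exact: QM.
exists (join A); split=> // u v uvA; apply: contrapT => /negP.
rewrite negb_or => /andP[uA vA].
have powin x : x \notin join A -> exists k, g ^+ k \in ideal_adjoin (join A) x.
  move=> xA; apply: contrapT => /forallNP gx.
  have gx' k : g ^+ k \notin ideal_adjoin (join A) x by apply/negP.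
  move/negP: xA; apply; apply: (max (ideal_adjoin (join A) x)) => //.
  - exact: ideal_adjoin_closed (gx' 0%N).
  - exact: sub_ideal_adjoin.
  - exact: mem_ideal_adjoin.
have [k /asboolP[p [a [pA gk]]]] := powin u uA.
have [l /asboolP[q [b [qA gl]]]] := powin v vA.
case/negP: (gA (k + l)%N); rewrite exprD gk gl.
rewrite mulrDr !mulrDl [p * _]mulrC [a * u * (b * v)]mulrACA [p * (b * v)]mulrC.
by do 3?[apply: idealr_closedD=> //]; apply: idealr_closedM.
Qed.

Lemma sub_maximal_ideal I : idealr_closed I ->
  exists2 Q, maximal_ideal Q & prime_idealr_closed Q /\ {subset I <= Q}.
Proof.
move=> Iid; have [k|P [Pid Pp IP P1 Pmax]] := @exists_prime_avoiding I 1 Iid.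
  by rewrite expr1n; case: Iid.
exists P => //; split=> // Q Qid PQ; apply: Pmax => // k.
by rewrite expr1n; case: Qid.
Qed.

Lemma local_sub I P : is_local_ring P -> idealr_closed I -> {subset I <= P}.
Proof.
move=> [_ Puniq] /sub_maximal_ideal[Q Qmax [_ IQ]] x /IQ.
by rewrite (Puniq Q Qmax).
Qed.

Lemma local_prime P : is_local_ring P -> prime_idealr_closed P.
Proof.
move=> [[Pid _] Puniq]; have [Q Qmax [Qp _]] := sub_maximal_ideal Pid.
by move=> u v; rewrite -!(Puniq Q Qmax); exact: Qp.
Qed.

End Ideals.

(** Otherwise a prime containing b and avoiding g would lie strictly between
    the zero ideal and the maximal ideal. *)
Lemma local_dim1_power (R : idomainType) (P : {pred R}) (b g : R) :
    is_local_ring P -> ~ prime_chain R 2 -> b != 0 -> g \in P ->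
  exists k r, g ^+ k = r * b.
Proof.
move=> Ploc dim b0 gP; apply: contrapT => /forallNP gb.
pose bR : {pred R} := fun x => `[< exists r, x = r * b >].
have gbR k : g ^+ k \notin bR by apply/negP => /asboolP; exact: gb.
have bRid : idealr_closed bR.
  split=> [||a x y /asboolP[r ->] /asboolP[s ->]].
  - by apply/asboolP; exists 0; rewrite mul0r.
  - exact: (gbR 0%N).
  - by apply/asboolP; exists (a * r + s); rewrite mulrDl mulrA.
have [Q [Qid Qp bQ gQ _]] := exists_prime_avoiding bRid gbR.
have bQ' : b \in Q by apply/bQ/asboolP; exists 1; rewrite mul1r.
have [[Pid _] _] := Ploc.
have P0 : idealr_closed (pred1 0 : {pred R}).
  split=> [||a x y /eqP-> /eqP->]; rewrite !inE ?oner_eq0 //.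
  by rewrite mulr0 addr0.
apply: dim; exists (fun i : 'I_3 =>
  match val i return {pred R} with 0 => pred1 0 | 1 => Q | _ => P end).
split=> [[[|[|[|//]]] ?] /=|].
- by split=> // u v; rewrite !inE mulf_eq0.
- by [].
- by split=> //; exact: local_prime.
move=> [[|[|[|//]]] ?] [[|[|[|//]]] ?] //= _; split.
- by move=> x /eqP->; case: Qid.
- by move=> /(_ b bQ'); rewrite inE (negPf b0).
- by move=> x /eqP->; case: Pid.
- by move=> /(_ b (local_sub Ploc Qid bQ')); rewrite inE (negPf b0).
- exact: local_sub.
- by move=> /(_ g gP); apply/negP; exact: (gQ 1%N).
Qed.

(** Otherwise the larger ideal of a chain of length one, being contained in the
    maximal ideal, would be zero. *)
Lemma local_dim1_nonzero (R : idomainType) (P : {pred R}) :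
  is_local_ring P -> prime_chain R 1 -> exists2 b, b \in P & b != 0.
Proof.
move=> Ploc [C [Cid /(_ 0 (ord_max : 'I_2) isT)[_ nsub]]].
apply: contrapT => /forall2NP Pz; apply: nsub => x xC.
have [C1id _] := Cid ord_max; have [[C00 _ _] _] := Cid 0.
have [[]|/negP] := Pz x; first exact: (local_sub Ploc C1id).
by rewrite negbK => /eqP->.
Qed.

(** * The local case *)

(** Below, the g i are the generators t ^ z i of the maximal ideal, viewed in R.
    Hypothesis [t_ideal] says that the elements of R in t Rbar lie in that
    ideal, and [g_power] that every nonzero ideal contains a power of each
    generator. *)
Section Filtration.
Variables (R : idomainType) (t : {fraction R}) (e : nat).
Variables (z : 'I_e -> nat) (g : 'I_e -> R).
Local Notation K := {fraction R}.
Hypothesis t_neq0 : t != 0.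
Hypothesis t_int : integralOver (@FracField.tofrac R) t.
Hypothesis gE : forall i, (g i)%:F = t ^+ z i.
Hypothesis z_gt0 : forall i, (0 < z i)%N.
Hypothesis t_ideal : forall r : R, r%:F / t \in integral_pred (R := R) ->
  exists c : 'I_e -> R, r = \sum_i c i * g i.
Hypothesis g_power : forall (b : R) i, b != 0 -> exists k r, g i ^+ k = r * b.

(** Membership in t ^ n Rbar, where Rbar is the integral closure.  This is a
    one-constructor inductive and not a definition because comparing fractions
    by unfolding the integrality predicate is intractable. *)
Variant t_order (n : int) (x : K) : Prop :=
  TOrder of x / t ^ n \in integral_pred (R := R).

Lemma t_orderD n x y : t_order n x -> t_order n y -> t_order n (x + y).
Proof. by case=> xn [yn]; constructor; rewrite mulrDl; exact: rpredD xn yn. Qed.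

Lemma t_orderN n x : t_order n x -> t_order n (- x).
Proof. by case=> xn; constructor; rewrite mulNr rpredN. Qed.

Lemma t_order0 n : t_order n 0.
Proof. by constructor; rewrite mul0r rpred0. Qed.

Lemma t_orderZ n (r : R) x : t_order n x -> t_order n (r *: x).
Proof.
case=> xn; constructor; rewrite scale_fracE -mulrA.
by apply: rpredM xn; exact: integral_frac.
Qed.

Lemma t_order_sum n m (x : 'I_m -> K) :
  (forall i, t_order n (x i)) -> t_order n (\sum_i x i).
Proof.
move=> xn; apply: (big_ind (t_order n)) => //; [exact: t_order0|exact: t_orderD].
Qed.

Lemma t_order_exp (n d : int) : (n <= d)%R -> t_order n (t ^ d).
Proof.
move=> nd; constructor; rewrite invr_expz -expfzDr //.
have -> : d - n = absz (d - n) by lia.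
by apply: rpredX; apply/asboolP.
Qed.

Lemma t_order_le (n d : int) x : (n <= d)%R -> t_order d x -> t_order n x.
Proof.
move=> nd [xd]; constructor.
have -> : x / t ^ n = (x / t ^ d) * (t ^ d / t ^ n) by rewrite mulrA divfK // expfz_neq0.
by apply: rpredM xd _; case: (t_order_exp nd).
Qed.

Section MonomialModule.
Variables (h : nat) (d : 'I_h -> int) (L : submodClosed K).
Hypothesis LE : L =i lspan (range (fun j => t ^ d j)).

(** The set generated by the d j under adding the z i.  Every t ^ n with n in it
    lies in L; the converse may fail, but only these exponents come with an
    explicit factorization, which [deep_divisible] exploits. *)
Definition exponent (n : int) := exists j (c : 'I_e -> nat),
  n = d j + (\sum_i c i * z i)%N%:Z.

Definition tail (n : int) := lspan [set t ^ p | p in [set p | exponent p /\ (n <= p)%R]].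

HB.instance Definition _ n := GRing.SubmodClosed.on (tail n).

Lemma prod_gE (c : 'I_e -> nat) :
  (\prod_i g i ^+ c i)%:F = t ^+ (\sum_i c i * z i)%N.
Proof.
rewrite rmorph_prod expr_sum; apply: eq_bigr => i _.
by rewrite rmorphXn /= gE -exprM mulnC.
Qed.

Lemma exponentD n i : exponent n -> exponent (n + (z i)%:Z).
Proof.
move=> [j [c ->]]; exists j, (fun i' => c i' + (i' == i))%N.
have -> : (\sum_i' (c i' + (i' == i)) * z i' = \sum_i' c i' * z i' + z i)%N.
  rewrite (eq_bigr _ (fun i' _ => mulnDl _ _ _)) big_split /= [X in (_ + X)%N](bigD1 i) //=.
  by rewrite eqxx mul1n [X in (_ + (_ + X))%N]big1 ?addn0 // => i' /negPf->.
by rewrite PoszD addrA.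
Qed.

Lemma exponent_mem n : exponent n -> t ^ n \in L.
Proof.
move=> [j [c ->]]; rewrite expfzDr // mulrC -exprnP -prod_gE.
by apply: rpredZ; rewrite LE; apply: mem_lspan; exists j.
Qed.

Lemma tail_sub n : {subset tail n <= L}.
Proof. by apply: lspan_sub => _ [p [pd _] <-]; exact: exponent_mem. Qed.

Lemma tail_order n : forall x, x \in tail n -> t_order n x.
Proof.
apply: lspan_ind => [|r _ y [p [_ np] <-]]; first exact: t_order0.
by apply: t_orderD; apply/t_orderZ/t_order_exp.
Qed.

(** Isolates the coefficient of t ^ n. *)
Lemma tail_step n x : x \in tail n ->
  exists (c : R) y, [/\ x = c *: t ^ n + y, y \in tail (n + 1) & c = 0 \/ exponent n].
Proof.
move: x; apply: lspan_ind => [|r _ y [p [pd np] <-] [c [y' [-> y'n cP]]]].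
  by exists 0, 0; rewrite scale0r addr0; split; [by []|exact: rpred0|by left].
move: pd np; have [->|np'] := eqVneq p n => pd np.
  by exists (r + c), y'; rewrite scalerDl addrA; split=> //; right.
exists c, (r *: t ^ p + y'); rewrite addrCA; split=> //; apply: rpredD y'n.
by apply: rpredZ; apply: mem_lspan; exists p => //; split=> //; lia.
Qed.

(** By induction on n: a combination of the t ^ p with p >= q lies in
    t ^ (q + 1) Rbar only if the coefficient of t ^ q lies in the maximal ideal;
    expanding that coefficient in the generators t ^ z i raises the exponent. *)
Lemma mem_tail n x : x \in L -> t_order n x -> x \in tail n.
Proof.
move=> xL.
have base p : (forall j, p <= d j)%R -> x \in tail p.
  move=> pd; move: xL; rewrite LE; apply: lspan_sub => _ [j _ <-].
  apply: mem_lspan; exists (d j) => //; split=> //; exists j, (fun=> 0%N).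
  by rewrite big1 ?addr0.
pose p : int := - (\sum_j absz (d j))%N%:Z.
have p_le j : (p <= d j)%R by rewrite /p (bigD1 j) //=; lia.
have [np _|pn] : (n <= p)%R \/ (p <= n)%R by lia.
  by apply: base => j; have := p_le j; lia.
have -> : n = p + (absz (n - p))%:Z by lia.
elim: (absz _) => [|k IHk] xn; first by rewrite addr0 in xn *; exact: base.
have pk1 : p + k.+1%:Z = p + k%:Z + 1 by lia.
rewrite pk1 in xn *; set q := p + k%:Z in IHk xn *.
have {IHk} /tail_step[c [y [xE yq cP]]] : x \in tail q.
  by apply: IHk; apply: t_order_le xn; lia.
rewrite xE rpredD //; case: cP => [->|qd]; first by rewrite scale0r rpred0.
have [a ->] : exists a : 'I_e -> R, c = \sum_i a i * g i.
  apply: t_ideal.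
  have: t_order (q + 1) (c *: t ^ q).
    rewrite -(addrK y (c *: _)) -xE; apply: t_orderD xn _.
    exact/t_orderN/(tail_order yq).
  suff -> : c%:F / t = (c *: t ^ q) / t ^ (q + 1) by case.
  by rewrite scale_fracE [t ^ (q + 1)]expfzDr // expr1z invfM mulrA mulfK ?expfz_neq0.
rewrite scaler_suml rpred_sum // => i _.
rewrite -scalerA rpredZ //; apply: mem_lspan; exists (q + (z i)%:Z).
  by split; [exact: exponentD|have := z_gt0 i; lia].
by rewrite [t ^ (q + _)]expfzDr // mulrC -exprnP -gE.
Qed.

(** A large exponent d j + sum_i c i * z i has some large c i, so that the
    monomial is a multiple of a power of g i that is divisible by b. *)
Lemma deep_divisible (b : R) : b != 0 ->
  exists N : nat, forall x, x \in L -> t_order N%:Z x -> exists2 y, y \in L & x = b *: y.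
Proof.
move=> b0; have /choice[k /(_ _)/cid kP] i := g_power i b0.
(* If c i < k i for all i, the exponent is less than N. *)
pose N := (\sum_j absz (d j) + \sum_i k i * z i).+1.
exists N => x xL /(mem_tail xL); move: x {xL}.
apply: lspan_ind => [|r _ x [p [[j [c pE]] Np] <-] [y yL ->]].
  by exists 0; rewrite ?rpred0 ?scaler0.
suff [y' y'L ->] : exists2 y', y' \in L & t ^ p = b *: y'.
  exists (r *: y' + y); first by rewrite rpredD ?rpredZ.
  by rewrite scalerDr !scalerA mulrC.
have [i ki] : exists i, (k i <= c i)%N.
  apply: contrapT => /forallNP kc.
  have : (\sum_i c i * z i <= \sum_i k i * z i)%N.
    apply: leq_sum => i _; rewrite leq_mul2r; apply/orP; right.
    by have /negP := kc i; lia.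
  have : (absz (d j) <= \sum_j absz (d j))%N by rewrite (bigD1 j) //= leq_addr.
  by move: Np; rewrite /N pE; lia.
have [s gs] := kP i.
exists ((s * g i ^+ (c i - k i) * \prod_(i' | i' != i) g i' ^+ c i') *: t ^ d j).
  by apply: rpredZ; rewrite LE; apply: mem_lspan; exists j.
rewrite pE expfzDr // mulrC -exprnP -prod_gE scalerA; congr (_%:F * _).
by rewrite (bigD1 i) //= -{1}(subnKC ki) exprD gs !mulrA [b * s]mulrC.
Qed.

End MonomialModule.

Section Descent.
Variables (m : nat) (h : 'I_m -> nat) (d : forall i, 'I_(h i) -> int).
Variable L : 'I_m -> submodClosed K.
Hypothesis h_gt0 : forall i, (0 < h i)%N.
Hypothesis LE : forall i, L i =i lspan (range (fun j : 'I_(h i) => t ^ d j)).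

Lemma common_multiplier : exists2 b : R, b != 0 &
  forall i j x, x \in L i -> b *: x \in L j.
Proof.
pose T := ({i : 'I_m & 'I_(h i)} * 'I_m)%type.
have [|b b0 bP] := @exists_multiplier R T
  (fun u => t ^ @d (tag u.1) (tagged u.1)) (fun u => t ^ @d u.2 (Ordinal (h_gt0 u.2))).
  by move=> u; exact: expfz_neq0.
exists b => // i j x; rewrite LE.
apply: (@lspan_linear _ _ _ (b \*: idfun)) => _ [k _ <-] /=.
have [r] := bP (Tagged (fun i => 'I_(h i)) k, j).
rewrite -!scale_fracE /= => ->; apply: rpredZ; rewrite LE; apply: mem_lspan.
by exists (Ordinal (h_gt0 j)).
Qed.

(** Deep enough in the filtration, all the entries lie in all of the L j. *)
Lemma deep_boundary : exists N : nat, forall w : 'I_m -> K, (forall i, w i \in L i) ->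
  (forall i, t_order N%:Z (w i)) -> \sum_i w i = 0 -> boundary L w.
Proof.
have [b b0 bL] := common_multiplier.
have /choice[N NP] i := deep_divisible (LE i) b0.
exists (\sum_i N i)%N => w wL wN w0.
have wLL i j : w i \in L j.
  have [|y yL ->] := NP i (w i) (wL i); last exact: bL yL.
  by apply: t_order_le (wN i) => //; rewrite (bigD1 i) //=; lia.
have [l _|noi] := pickP (fun _ : 'I_m => true).
  by apply: (@boundary_star _ _ _ _ l).
by exists (fun _ _ => 0); split=> [i|i]; have := noi i.
Qed.

(** Write w i = c i t ^ n + y i with y i of larger order.  Replacing one of the
    nonzero c l by c l - s, where s is the sum of the c i, gives a relation with
    sum zero on t ^ n alone.  As s t ^ n is minus the sum of the y i, it has
    larger order, so that subtracting this relation from w leaves entries of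
    larger order. *)
Lemma descent_step (n : int) :
  (forall w : 'I_m -> K, (forall i, w i \in L i) -> (forall i, t_order (n + 1) (w i)) ->
    \sum_i w i = 0 -> boundary L w) ->
  forall w : 'I_m -> K, (forall i, w i \in L i) -> (forall i, t_order n (w i)) ->
    \sum_i w i = 0 -> boundary L w.
Proof.
move=> IH w wL wn w0.
have tail_w i := mem_tail (LE i) (wL i) (wn i).
have /choice[c /choice[y cyP]] i := tail_step (tail_w i).
have yn i : t_order (n + 1) (y i).
  by case: (cyP i) => _ yt _; exact: tail_order yt.
have yL i : y i \in L i.
  by case: (cyP i) => _ yt _; exact: (tail_sub (LE i)) yt.
(* If t ^ n occurs in none of the modules, w is already of larger order. *)
have [[l dl]|nod] := pselect (exists l, exponent (@d l) n); last first.
  apply: IH => // i; case: (cyP i) => -> yt [->|di]; last by case: nod; exists i.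
  by rewrite scale0r add0r.
have tL i : exponent (@d i) n -> t ^ n \in L i.
  exact: (exponent_mem (LE i)).
pose s := \sum_i c i.
pose c' i := c i - (if i == l then s else 0).
have sn : t_order (n + 1) (s *: t ^ n).
  rewrite -[s *: _](addrK (\sum_i y i)) [X in X - _](_ : _ = \sum_i w i).
    by rewrite w0 sub0r; apply/t_orderN/t_order_sum.
  by rewrite scaler_suml -big_split; apply: eq_bigr => i _; case: (cyP i).
have c'0 : \sum_i c' i = 0.
  by rewrite sumrB -big_mkcond big_pred1_eq subrr.
pose u i : K := c' i *: t ^ n.
have uL i : u i \in L i.
  rewrite /u /c'; case: eqP => [->|_]; first by rewrite rpredZ // tL.
  rewrite subr0; case: (cyP i) => _ _ [->|di]; first by rewrite scale0r rpred0.
  by rewrite rpredZ // tL.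
have u0 : \sum_i u i = 0 by rewrite -scaler_suml c'0 scale0r.
pose v i : K := w i - u i.
have vL i : v i \in L i by apply: submodB.
have vn i : t_order (n + 1) (v i).
  have -> : v i = y i + (if i == l then s else 0) *: t ^ n.
    case: (cyP i) => wE _ _; rewrite /v wE /u /c' scalerBl opprB.
    by rewrite [LHS]addrC addrA subrK addrC.
  by apply: t_orderD => //; case: eqP => // _; rewrite scale0r; exact: t_order0.
have v0 : \sum_i v i = 0 by rewrite sumrB w0 u0 subrr.
have -> : w = (fun i => u i + v i : K) by apply/funext => i; rewrite addrC subrK.
apply: boundaryD (IH v vL vn v0).
by apply: (@boundary_star _ _ _ _ l) => // i; split; [exact: uL|rewrite rpredZ // tL].
Qed.

Lemma descent_exact : exact_at L.
Proof.
have [N NP] := deep_boundary.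
have low i : exists p : nat, forall w : K, w \in L i -> t_order (- p%:Z) w.
  exists (\sum_(j < h i) absz (@d i j))%N => w; rewrite LE.
  move: w; apply: lspan_ind => [|r _ w [j _ <-] wt]; first exact: t_order0.
  apply: t_orderD => //; apply/t_orderZ/t_order_exp => //.
  by rewrite (bigD1 j) //=; lia.
have /choice[p pP] := low.
have down (k : nat) : forall w : 'I_m -> K, (forall i, w i \in L i) ->
    (forall i, t_order (N%:Z - k%:Z) (w i)) -> \sum_i w i = 0 -> boundary L w.
  elim: k => [|k IHk]; first by rewrite subr0.
  by apply: descent_step; have -> : N%:Z - k.+1%:Z + 1 = N%:Z - k%:Z by lia.
move=> w wL w0; apply: (down (N + \sum_i p i)%N) => // i.
by apply: t_order_le (pP i _ (wL i)) => //; rewrite (bigD1 i) //=; lia.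
Qed.

End Descent.

End Filtration.

Section LocalCase.
Variables (R : idomainType).
Local Notation K := {fraction R}.

Lemma local_power (S : comNzRingType) (P : {pred S}) (x : S) n :
  is_local_ring P -> x ^+ n \in P -> x \in P.
Proof.
move=> Ploc; have [[[_ P1 _] _] _] := Ploc.
elim: n => [|n IHn]; first by rewrite expr0 (negPf P1).
by rewrite exprS => /(local_prime Ploc)/orP[].
Qed.

(** Some t ^ z i is a nonzero nonunit, so that t is nonzero and, by primality,
    lies in the maximal ideal of the integral closure.  The latter contracts to
    the maximal ideal of R, which gives the property of the quotients r / t. *)
Lemma local_case_parameter (mon : set K) : local_case mon ->
  exists (t : K) (e : nat) (z : 'I_e -> nat) (g : 'I_e -> R),
    [/\ mon = range (fun j : int => t ^ j), t != 0 & integralOver (@FracField.tofrac R) t] /\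
    [/\ forall i, (g i)%:F = t ^+ z i, forall i, (0 < z i)%N,
        forall r : R, r%:F / t \in integral_pred (R := R) ->
          exists c : 'I_e -> R, r = \sum_i c i * g i &
        forall (b : R) i, b != 0 -> exists k r, g i ^+ k = r * b].
Proof.
move=> [mm [[mmloc _ [dim1 dim2] _ [nn [nnloc nnE _]]] [t [e [z [t_int mmE ->]]]]]].
have mem_mm (r : R) : (r \in mm) <-> (r%:F \in lspan (range (fun i => t ^+ z i))).
  split=> [rm|rs].
    by have : [set` lspan (range (fun i => t ^+ z i))] r%:F by rewrite -mmE; exists r.
  have [s sm /eqP] : [set r%:F | r in [set` mm]] r%:F by rewrite mmE.
  by rewrite tofrac_eq => /eqP<-.
have /choice[g gP] i : exists r : R, r \in mm /\ r%:F = t ^+ z i.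
  have : [set r%:F | r in [set` mm]] (t ^+ z i).
    by rewrite mmE; apply: mem_lspan; exists i.
  by move=> [r rm <-]; exists r.
have [[[_ mm1 _] _] _] := mmloc; have [[nnid _] _] := nnloc.
have [b bm b0] := local_dim1_nonzero mmloc dim1.
have [i0 ti0] : exists i, t ^+ z i != 0.
  apply: contrapT => /forallNP tz; case/negP: b0; rewrite -tofrac_eq0.
  move/mem_mm: bm; move: (b%:F); apply: lspan_ind => [//|r _ x [i _ <-] /eqP->].
  by have /negP := tz i; rewrite negbK => /eqP->; rewrite scaler0 addr0.
have z_gt0 i : (0 < z i)%N.
  rewrite lt0n; apply/negP => /eqP zi0; case/negP: mm1.
  by case: (gP i) => gm /eqP; rewrite zi0 expr0 -tofrac1 tofrac_eq => /eqP <-.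
have t_neq0 : t != 0.
  by apply: contraNneq ti0 => ->; rewrite expr0n eqn0Ngt z_gt0.
exists t, e, z, g; split=> //; split=> // [i|r rt|c i c0]; first by case: (gP i).
  pose tau : integral_closure R := exist _ t (asboolT t_int).
  pose q : integral_closure R := exist _ (r%:F / t) rt.
  have tau_nn : tau \in nn.
    apply: (local_power (n := z i0) nnloc).
    have <- : to_integral_closure (g i0) = tau ^+ z i0.
      by apply: val_inj; rewrite rmorphXn /=; case: (gP i0).
    by rewrite nnE; case: (gP i0).
  have /mem_mm/lspan_rangeP[c rE] : r \in mm.
    rewrite -nnE; have -> : to_integral_closure r = q * tau.
      by apply: val_inj; rewrite rmorphM /= divfK.
    exact: idealr_closedM.
  exists c; apply/eqP; rewrite -tofrac_eq rE rmorph_sum; apply/eqP.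
  by apply: eq_bigr => i _; case: (gP i) => _ <-; rewrite rmorphM.
by apply: (local_dim1_power mmloc dim2 c0); case: (gP i).
Qed.

Lemma local_exact_monomials (mon : set K) : local_case mon -> exact_monomials mon.
Proof.
move=> /local_case_parameter[t [e [z [g [[-> t0 t_int] [gE z_gt0 t_ideal g_power]]]]]].
split=> [_ [j _ <-]|_ _ [j _ <-] [j' _ <-]|m L Lmon].
- exact: expfz_neq0.
- by exists (j + j'); rewrite ?expfzDr.
have /choice[hd hdP] i : exists hd : {h & 'I_h -> int}, (0 < tag hd)%N /\
    L i =i lspan (range (fun j => t ^ tagged hd j)).
  have [[_ [x xL x0]] [h [c [cmon LE]]]] := Lmon i.
  have /choice[d dP] j : exists d : int, c j = t ^ d.
    by case: (cmon j) => d _ <-; exists d.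
  exists (Tagged (fun h => 'I_h -> int) d); split=> /=.
    clear d dP cmon; case: h c LE => [c LE|//]; case/negP: x0; move: xL; rewrite LE.
    by move: x; apply: lspan_ind => [//|r y y' [[]]].
  by move=> y; rewrite LE (_ : c = fun j => t ^ d j)//; exact/funext.
apply: (descent_exact t0 t_int gE z_gt0 t_ideal g_power
  (h := fun i => tag (hd i)) (d := fun i => tagged (hd i))) => i.
  by case: (hdP i).
by case: (hdP i).
Qed.

End LocalCase.

(** * Quotients, free modules and tensor products *)

Lemma pi_quotientZ (R : pzRingType) (V : lmodType R) (N : submodClosed V) r x :
  \pi_(quotient_module N) (r *: x) = r *: \pi_(quotient_module N) x.
Proof. by rewrite -pi_quotient_scale. Qed.

Lemma pi_quotient_eq0 (R : pzRingType) (V : lmodType R) (N : submodClosed V) x :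
  (\pi_(quotient_module N) x = 0) <-> (x \in N).
Proof.
rewrite -[0](raddf0 \pi_(Quotient.quot (submod_as_zmod N))).
by rewrite quotient_modP subr0.
Qed.

Lemma pi_quotient_sum (R : pzRingType) (V : lmodType R) (N : submodClosed V)
    (T : Type) (s : seq T) (x : T -> V) :
  \pi_(quotient_module N) (\sum_(t <- s) x t) = \sum_(t <- s) \pi_(quotient_module N) (x t).
Proof.
elim/big_rec2: _ => [|t u v _ <-]; last exact: pi_quotientD.
by apply/pi_quotient_eq0; exact: rpred0.
Qed.

(** First isomorphism theorem for G, in the direction from the image to the
    quotient: send s to the class of any preimage. *)
Lemma subquotient_iso (R : pzRingType) (V T : lmodType R)
    (M N : submodClosed V) (S : submodClosed T) (G : {linear submodule M -> T}) :
    (forall v, G v \in S) -> (forall v, (G v = 0) <-> (val v \in N)) ->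
    (forall s, s \in S -> exists v, G v = s) ->
  lmod_isomorphic (submodule S) (subquotient M N).
Proof.
move=> GS G0 Gsurj.
have /choice[v vG] (s : submodule S) : exists v, G v = val s.
  exact/Gsurj/valP.
have piE x y : (\pi_(subquotient M N) x = \pi_(subquotient M N) y) <-> G x = G y.
  rewrite quotient_modP -[x - y \in _]/(val (x - y) \in N) -G0 linearB.
  by split=> [/subr0_eq|E]; rewrite ?E ?subrr.
pose f s : subquotient M N := \pi_(subquotient M N) (v s).
have flin : linear f.
  move=> r s s'; rewrite /f.
  transitivity (\pi_(subquotient M N) (r *: v s + v s')).
    by apply/piE; rewrite linearP !vG.
  by rewrite [LHS]pi_quotientD; congr (_ + _); exact: pi_quotientZ.
pose flinM := GRing.isLinear.Build R (submodule S) (subquotient M N) *:%R f flin.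
pose F : {linear submodule S -> subquotient M N} := HB.pack f flinM.
exists F; pose h (q : subquotient M N) : submodule S := exist _ (G (repr q)) (GS _).
exists h => [s|q]; last first.
  by rewrite -[RHS]reprK; apply/piE; rewrite vG.
by apply: val_inj; rewrite /= -vG; apply/piE; rewrite reprK.
Qed.

(** Universal property of the free module. *)
Lemma freeg_lift (R : nzRingType) (T : choiceType) (M : lmodType R) (f : T -> M) :
  exists F : {linear {freeg T / R} -> M}, forall x, F << x >> = f x.
Proof.
pose FM := GRing.isZmodMorphism.Build _ M (fglift f) (lift_is_additive f).
pose F0 : {additive {freeg T / R} -> M} := HB.pack (fglift f) FM.
have FE D : F0 D = \sum_(x <- dom D) coeff x D *: f x.
  rewrite -{1}[D]freeg_sumE raddf_sum; apply: eq_bigr => x _; exact: liftU.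
have Fscal : scalable F0.
  move=> r D; rewrite [in RHS]FE scaler_sumr [LHS](raddf_sum F0).
  by apply: eq_bigr => x _; rewrite [LHS]liftU scalerA.
pose FS := GRing.isScalable.Build R _ M *:%R F0 Fscal.
pose F : {linear {freeg T / R} -> M} := HB.pack (fglift f) FM FS.
by exists F => x; rewrite [LHS]liftU scale1r.
Qed.

Lemma freegUE (R : nzRingType) (T : choiceType) (k : R) (x : T) :
  << k *g x >> = k *: << x >> :> {freeg T / R}.
Proof.
by apply/eqP/freeg_eqP => y; rewrite coeffZ !coeffU mul1r.
Qed.

Section TensorCalculus.
Variables (R : comNzRingType) (M N : lmodType R).

Definition pure (x : M) (y : N) : tensor M N := \pi_(tensor M N) << (x, y) >>.

Let tensor_eq (u v : {freeg (M * N)%type / R}) :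
  tensor_relations (u - v) -> \pi_(tensor M N) u = \pi_(tensor M N) v.
Proof. by move=> uv; apply/quotient_modP/mem_lspan. Qed.

Lemma pureDl x x' y : pure (x + x') y = pure x y + pure x' y.
Proof.
rewrite /pure -pi_quotientD; apply: tensor_eq; constructor 1.
by exists x, x', y; rewrite opprD addrA.
Qed.

Lemma pureDr x y y' : pure x (y + y') = pure x y + pure x y'.
Proof.
rewrite /pure -pi_quotientD; apply: tensor_eq; constructor 2.
by exists x, y, y'; rewrite opprD addrA.
Qed.

Lemma pureZl r x y : pure (r *: x) y = r *: pure x y.
Proof.
rewrite /pure -pi_quotientZ; apply: tensor_eq; constructor 3.
by exists r, x, y.
Qed.

Lemma pureZr r x y : pure x (r *: y) = r *: pure x y.
Proof.
rewrite /pure -pi_quotientZ; apply: tensor_eq; constructor 4.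
by exists r, x, y.
Qed.

Lemma pure0r x : pure x 0 = 0.
Proof. by rewrite -(scale0r 0) pureZr scale0r. Qed.

Lemma pure_sumr (T : Type) (s : seq T) x (y : T -> N) :
  pure x (\sum_(t <- s) y t) = \sum_(t <- s) pure x (y t).
Proof. by elim/big_rec2: _ => [|t u v _ <-]; rewrite ?pure0r ?pureDr. Qed.

Lemma pure_suml (T : Type) (s : seq T) (x : T -> M) y :
  pure (\sum_(t <- s) x t) y = \sum_(t <- s) pure (x t) y.
Proof.
elim/big_rec2: _ => [|t u v _ <-]; last by rewrite pureDl.
by rewrite -(scale0r 0) pureZl scale0r.
Qed.

End TensorCalculus.

(** * The presentation of the torsion submodule *)

Section ScaledModule.
Variable R : idomainType.
Local Notation K := {fraction R}.
Implicit Types (c x : K) (M : submodClosed K).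

Definition scaled_module c M := lspan [set c * y | y in [set` M]].

HB.instance Definition _ c M := GRing.SubmodClosed.on (scaled_module c M).

Lemma scaled_moduleP c M x :
  (x \in scaled_module c M) <-> (exists2 y, y \in M & x = c * y).
Proof.
split=> [|[y yM ->]]; last by apply: mem_lspan; exists y.
move: x; apply: lspan_ind => [|r _ x [y yM <-] [y' y'M ->]].
  by exists 0; rewrite ?rpred0 ?mulr0.
by exists (r *: y + y'); rewrite ?rpredD ?rpredZ // mulrDr !scale_fracE mulrCA.
Qed.

(** R as a submodule of its fraction field. *)
Definition scalars := lspan [set (1 : K)].

HB.instance Definition _ := GRing.SubmodClosed.on scalars.

Lemma scalarsP x : (x \in scalars) <-> exists r : R, x = r%:F.
Proof.
split=> [|[r ->]]; last by rewrite -[r%:F]mulr1; exact/rpredZ/mem_lspan.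
move: x; apply: lspan_ind => [|r _ x -> [s ->]]; first by exists 0; rewrite rmorph0.
by exists (r + s); rewrite scale_fracE mulr1 rmorphD.
Qed.

Lemma scaled_monomial_ideal (mon : set K) c M (h : nat) (b : 'I_h -> K) :
    c != 0 -> (exists2 x, x \in M & x != 0) -> M =i lspan (range b) ->
    (forall j, mon (c * b j)) ->
  monomial_fractional_ideal mon (scaled_module c M).
Proof.
move=> c0 [x xM x0] Mb cb.
have ME : scaled_module c M =i lspan (range (fun j => c * b j)).
  move=> y; apply/idP/idP => [/scaled_moduleP[y' y'M ->]|].
    move: y'M; rewrite Mb => /lspan_rangeP[d ->]; rewrite mulr_sumr.
    apply: rpred_sum => j _; rewrite scale_fracE mulrCA -scale_fracE.
    by apply: rpredZ; apply: mem_lspan; exists j.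
  apply: lspan_sub => {}y [j _ <-]; apply/scaled_moduleP; exists (b j) => //.
  by rewrite Mb; apply: mem_lspan; exists j.
split; last by exists h, (fun j => c * b j).
split; first by exists h, (fun j => c * b j).
exists (c * x); last by rewrite mulf_neq0.
by apply/scaled_moduleP; exists x.
Qed.

End ScaledModule.
Arguments scalars {R}.

Section Presentation.
Variables (R : idomainType) (m : nat).
Local Notation K := {fraction R}.
Local Notation V := {ffun 'I_m -> K}.
Local Notation tofrac := (@FracField.tofrac R).
Variables (a : 'I_m -> K) (I J : submodClosed K).
Variable e : 'I_m -> {ffun 'I_m -> R^o}.
Hypothesis a_neq0 : forall i, a i != 0.
Hypothesis I_gen : I =i lspan (range a).
Hypothesis e_basis : module_basis e.
Hypothesis exactR : exact_at (fun i => scaled_module (a i) scalars).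
Hypothesis exactJ : exact_at (fun i => scaled_module (a i) J).

(** The linear map of K ^ m with matrix e.  Families of coefficients w are used
    throughout and are transported to K ^ m along it. *)
Definition combine (w : 'I_m -> K) : V := [ffun l => \sum_i w i * tofrac (e i l)].

Lemma combineD w w' : combine (fun i => w i + w' i) = combine w + combine w'.
Proof.
apply/ffunP => l; rewrite !ffunE -big_split.
by apply: eq_bigr => i _; rewrite mulrDl.
Qed.

Lemma combineZ (r : R) w : combine (fun i => r *: w i) = r *: combine w.
Proof.
apply/ffunP => l; rewrite !ffunE scaler_sumr.
by apply: eq_bigr => i _; rewrite !scale_fracE mulrA.
Qed.

Lemma combine0 : combine (fun=> 0) = 0.
Proof. by apply/ffunP => l; rewrite !ffunE big1 // => i _; rewrite mul0r. Qed.

Lemma combine_sum (T : Type) (s : seq T) (w : T -> 'I_m -> K) :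
  combine (fun i => \sum_(t <- s) w t i) = \sum_(t <- s) combine (w t).
Proof.
elim: s => [|t s IHs].
  by rewrite big_nil -combine0; congr combine; apply/funext => i; rewrite big_nil.
rewrite big_cons -IHs -combineD; congr combine.
by apply/funext => i; rewrite big_cons.
Qed.

Lemma scaled_diffE (c : K) i j :
  scaled_diff e c i j =
    combine (fun l => (if l == i then c else 0) - (if l == j then c else 0)).
Proof.
apply/ffunP => l; rewrite !ffunE mulrBr.
under eq_bigr do rewrite mulrBl; rewrite sumrB.
have single i' : \sum_(l' < m) (if l' == i' then c else 0) * tofrac (e l' l) =
    c * tofrac (e i' l).
  by rewrite (bigD1 i') //= eqxx big1 ?addr0 // => l' /negPf->; rewrite mul0r.
by rewrite !single.
Qed.

Lemma combine_boundary (c : 'I_m -> 'I_m -> K) :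
  combine (fun i => \sum_j (c i j - c j i)) = \sum_i \sum_j scaled_diff e (c i j) i j.
Proof.
under [RHS]eq_bigr do under eq_bigr do rewrite scaled_diffE.
under [RHS]eq_bigr do rewrite -combine_sum.
rewrite -combine_sum; congr combine; apply/funext => l.
under [RHS]eq_bigr do rewrite sumrB.
rewrite !sumrB; congr (_ - _).
  rewrite [RHS](bigD1 l) //= eqxx [X in _ = _ + X]big1 ?addr0 // => i /negPf.
  by rewrite eq_sym => ->; rewrite big1.
apply: eq_bigr => i _.
rewrite [RHS](bigD1 l) //= eqxx [X in _ = _ + X]big1 ?addr0 // => j /negPf.
by rewrite eq_sym => ->.
Qed.

(** A basis of R ^ m stays independent over K: the matrix expressing the
    standard basis in terms of e is inverse to e on both sides. *)
Lemma combine_inverse : exists coord : V -> 'I_m -> K,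
  forall w, coord (combine w) = w.
Proof.
pose delta l : {ffun 'I_m -> R^o} := [ffun i => (i == l)%:R].
have /choice[f fE] l : exists f : {ffun 'I_m -> R}, delta l = \sum_i f i *: e i.
  by have [f [fE _]] := e_basis (delta l); exists f.
(* Substitute the expansions of the standard basis in e i and compare with
   e i itself; uniqueness of coordinates gives the orthogonality relations. *)
have dual i j : \sum_l e i l * f l j = (j == i)%:R.
  pose g := [ffun j => \sum_l e i l * f l j : R].
  pose g' := [ffun j : 'I_m => (j == i)%:R : R].
  have [h [_ huniq]] := e_basis (e i).
  have hg : h = g.
    apply: huniq; transitivity (\sum_l e i l *: delta l).
      apply/ffunP => l'; rewrite sum_ffunE (bigD1 l') //= /delta !ffunE eqxx big1 ?addr0.
        by rewrite [RHS]mulr1.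
      by move=> l /negPf; rewrite eq_sym !ffunE => ->; rewrite [LHS]mulr0.
    under eq_bigr do rewrite fE scaler_sumr.
    rewrite exchange_big /=; apply: eq_bigr => l _.
    rewrite ffunE scaler_suml; apply: eq_bigr => l' _; exact: scalerA.
  have hg' : h = g'.
    apply: huniq; rewrite (bigD1 i) //= ffunE eqxx scale1r big1 ?addr0 //.
    by move=> l /negPf li; rewrite ffunE li scale0r.
  by have := congr1 (fun h : {ffun _} => h j) (etrans (esym hg) hg'); rewrite !ffunE.
exists (fun v i => \sum_l v l * tofrac (f l i)) => w; apply/funext => i.
transitivity (\sum_j w j * (i == j)%:R); last first.
  rewrite (bigD1 i) //= eqxx mulr1 big1 ?addr0 // => j /negPf.
  by rewrite eq_sym => ->; rewrite mulr0.
under eq_bigr do rewrite ffunE mulr_suml.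
rewrite exchange_big /=; apply: eq_bigr => j _.
rewrite -[(i == j)%:R](rmorph_nat tofrac) -dual rmorph_sum mulr_sumr.
by apply: eq_bigr => l _; rewrite rmorphM mulrA.
Qed.

Definition coord : V -> 'I_m -> K := sval (cid combine_inverse).

Lemma combineK : cancel combine coord.
Proof. exact: (svalP (cid combine_inverse)). Qed.

(** The symmetric sum over pairs folds to a sum over i < j, since
    [scaled_diff] is antisymmetric in the pair. *)
Lemma combine_boundary_mem (M : submodClosed V) (c : 'I_m -> 'I_m -> K) :
  (forall i j : 'I_m, (i < j)%N ->
     scaled_diff e (c i j) i j \in M /\ scaled_diff e (c j i) i j \in M) ->
  combine (fun i => \sum_j (c i j - c j i)) \in M.
Proof.
move=> cM; rewrite combine_boundary; apply: rpred_sum => i _; apply: rpred_sum => j _.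
have [ij|ji|/val_inj ij] := ltngtP i j; first by case: (cM i j ij).
  have -> : scaled_diff e (c i j) i j = - scaled_diff e (c i j) j i.
    by apply/ffunP => l; rewrite !ffunE -mulrN opprB.
  by apply: submodN; case: (cM j i ji).
rewrite -ij (_ : scaled_diff _ _ _ _ = 0) ?rpred0 //.
by apply/ffunP => l; rewrite !ffunE subrr mulr0.
Qed.

(** The nontrivial direction is the exactness for the a i * J. *)
Lemma numeratorP v : (v \in numerator a J e) <-> exists w : 'I_m -> K,
  [/\ v = combine w, forall i, w i \in scaled_module (a i) J & \sum_i w i = 0].
Proof.
split=> [|[w [-> wJ w0]]]; last first.
  have [c [cJ wE]] := exactJ wJ w0.
  have -> : w = (fun i => \sum_j (c i j - c j i)) by apply/funext.
  have cset i j l : c i j \in scaled_module (a l) J -> [set a l * y | y in [set` J]] (c i j).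
    by move=> /scaled_moduleP[y yJ ->]; exists y.
  apply: combine_boundary_mem => i j ij.
  have [[cij cij'] [cji cji']] := (cJ i j, cJ j i).
  by split; apply: mem_lspan; [exists i, j, (c i j)|exists i, j, (c j i)];
    split=> //; split; exact: cset.
move: v; apply: lspan_ind =>
  [|r _ _ [i [j [c [ij [[y yJ yE] [y' y'J y'E]] ->]]]] [w [-> wJ w0]]].
  by exists (fun=> 0); rewrite combine0; split=> // [i|]; rewrite ?rpred0 ?big1.
exists (fun l => r *: ((if l == i then c else 0) - (if l == j then c else 0)) + w l).
split=> [|l|].
- by rewrite combineD combineZ -scaled_diffE.
- rewrite rpredD // rpredZ // submodB //.
    by case: eqP => [->|_]; rewrite ?rpred0 //; apply/scaled_moduleP; exists y.
  by case: eqP => [->|_]; rewrite ?rpred0 //; apply/scaled_moduleP; exists y'.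
- rewrite big_split /= w0 addr0 -scaler_sumr sumrB -!big_mkcond !big_pred1_eq subrr.
  by rewrite scaler0.
Qed.

(** By exactness for the a i R, the family r i a i splits into elements of the
    a i R meet a j R; multiply by y. *)
Lemma syzygy_denominator (r : 'I_m -> R) y : y \in J ->
  \sum_i r i *: a i = 0 -> combine (fun i => r i *: (a i * y)) \in denominator a J e.
Proof.
move=> yJ r0; have [|c [cR rE]] := exactR _ r0.
  move=> i; apply/scaled_moduleP; exists (r i)%:F; last by rewrite scale_fracE mulrC.
  by apply/scalarsP; exists (r i).
have -> : (fun i => r i *: (a i * y)) = (fun i => \sum_j (c i j * y - c j i * y)).
  apply/funext => i; rewrite scale_fracE mulrA -scale_fracE rE mulr_suml.
  by apply: eq_bigr => j _; rewrite mulrBl.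
have cset i j l : c i j \in scaled_module (a l) scalars ->
    [set a l * r%:F | r in [set: R]] (c i j).
  by move=> /scaled_moduleP[_ /scalarsP[s ->] ->]; exists s.
apply: combine_boundary_mem => i j ij.
have [[cij cij'] [cji cji']] := (cR i j, cR j i).
split; apply: mem_lspan; [exists i, j, (c i j * y)|exists i, j, (c j i * y)];
  split=> //; apply: mem_lspan.
  by exists (c i j); [split; exact: cset|exists y].
by exists (c j i); [split; exact: cset|exists y].
Qed.

Local Notation TIJ := (tensor (submodule I) (submodule J)).

Lemma gen_mem i : a i \in I.
Proof. by rewrite I_gen; apply: mem_lspan; exists i. Qed.

Definition gen i : submodule I := exist _ (a i) (gen_mem i).

(** Total for convenience: the value outside of J is 0. *)
Definition toJ (y : K) : submodule J := insubd 0 y.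

Lemma toJK y : y \in J -> val (toJ y) = y.
Proof. exact: insubdK. Qed.

Lemma toJ_linear r y y' : y \in J -> y' \in J -> toJ (r *: y + y') = r *: toJ y + toJ y'.
Proof.
move=> yJ y'J; apply: val_inj; rewrite toJK ?rpredD ?rpredZ //.
by rewrite linearP /= !toJK.
Qed.

Lemma scaled_div i x : x \in scaled_module (a i) J -> x / a i \in J.
Proof. by move=> /scaled_moduleP[y yJ ->]; rewrite mulrC mulKf. Qed.

(** The inverse of a_i (x) y |-> a_i y in place i. *)
Definition gen_sum (w : 'I_m -> K) : TIJ := \sum_i pure (gen i) (toJ (w i / a i)).

Lemma gen_sum_linear r w w' :
  (forall i, w i \in scaled_module (a i) J) -> (forall i, w' i \in scaled_module (a i) J) ->
  gen_sum (fun i => r *: w i + w' i) = r *: gen_sum w + gen_sum w'.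
Proof.
move=> wJ w'J; rewrite scaler_sumr -big_split; apply: eq_bigr => i _ /=.
rewrite mulrDl scale_fracE -mulrA -scale_fracE toJ_linear ?scaled_div //.
by rewrite pureDr pureZr.
Qed.

Lemma gen_sum_onto (z : TIJ) : exists w : 'I_m -> K,
  (forall i, w i \in scaled_module (a i) J) /\ z = gen_sum w.
Proof.
rewrite -[z]reprK; elim/freeg_ind_dom0: (repr z) => [|k [x y] D _ _ [w [wJ DE]]].
  exists (fun=> 0); split=> [i|]; first exact: rpred0.
  rewrite /gen_sum big1 => [|i _]; first by apply/pi_quotient_eq0; exact: rpred0.
  by rewrite mul0r (_ : toJ 0 = 0) ?pure0r //; apply: val_inj; rewrite toJK ?rpred0 // raddf0.
have [c xE] : exists c : 'I_m -> R, val x = \sum_i c i *: a i.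
  by apply: lspan_rangeP; rewrite -I_gen; exact: valP.
pose w1 i := c i *: (a i * val y) : K.
have w1J i : w1 i \in scaled_module (a i) J.
  by rewrite rpredZ //; apply/scaled_moduleP; exists (val y); [exact: valP|].
exists (fun i => k *: w1 i + w i); split=> [i|].
  by apply: rpredD; [apply: rpredZ; exact: w1J|exact: wJ].
rewrite gen_sum_linear // freegUE pi_quotientD pi_quotientZ DE; congr (k *: _ + _).
have -> : x = \sum_i c i *: gen i.
  by apply: val_inj; rewrite xE val_submod_sum; apply: eq_bigr => i _; rewrite val_submodZ.
rewrite -[LHS]/(pure _ y) pure_suml; apply: eq_bigr => i _.
rewrite /w1 scale_fracE mulrCA mulrAC mulfV // mul1r -scale_fracE.
rewrite pureZl -pureZr; congr pure; apply: val_inj.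
by rewrite val_submodZ toJK // rpredZ //; exact: valP.
Qed.

Lemma combineB w w' : combine (fun i => w i - w' i) = combine w - combine w'.
Proof.
apply/ffunP => l; rewrite !ffunE -sumrB.
by apply: eq_bigr => i _; rewrite mulrBl.
Qed.

Lemma gen_sum_pi w : gen_sum w =
  \pi_TIJ (\sum_i << (gen i, toJ (w i / a i)) >>).
Proof. by rewrite [RHS]pi_quotient_sum. Qed.

(** Choose r nonzero with r a i = s i a l for all i and a fixed l.  Multiplying
    by r moves all the terms to the single generator a l, with coefficient
    sum_i s i (w i / a i) = r / a l * sum_i w i = 0. *)
Lemma gen_sum_torsion w : (forall i, w i \in scaled_module (a i) J) ->
  \sum_i w i = 0 -> gen_sum w \in torsion TIJ.
Proof.
move=> wJ w0.
have [l _|none] := pickP (fun _ : 'I_m => true); last first.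
  rewrite /gen_sum big1 ?rpred0 // => i; by have := none i.
have [r r0 /choice[s sE]] := exists_multiplier a (fun _ : 'I_m => a_neq0 l).
apply/asboolP; exists r => //.
rewrite scaler_sumr (eq_bigr (fun i => pure (gen l) (s i *: toJ (w i / a i)))); last first.
  move=> i _; rewrite -pureZl pureZr -pureZl; congr pure.
  by apply: val_inj; rewrite !val_submodZ; exact: sE.
rewrite -pure_sumr (_ : \sum_i _ = 0) ?pure0r //; apply: val_inj.
rewrite val_submod_sum; apply: (mulfI (a_neq0 l)); rewrite mulr0 mulr_sumr.
transitivity (r *: \sum_i w i); last by rewrite w0 scaler0.
rewrite scaler_sumr; apply: eq_bigr => i _; rewrite val_submodZ.
rewrite toJK ?scaled_div // !scale_fracE mulrCA mulrA -sE -mulrA.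
by rewrite [a i * _]mulrC divfK.
Qed.

(** The multiplication map to K is defined on the tensor product, sends
    [gen_sum w] to the sum of w, and K is torsion free. *)
Lemma torsion_sum w : (forall i, w i \in scaled_module (a i) J) ->
  gen_sum w \in torsion TIJ -> \sum_i w i = 0.
Proof.
move=> wJ /asboolP[r r0]; rewrite gen_sum_pi -pi_quotientZ => /pi_quotient_eq0.
pose f (p : submodule I * submodule J) : K := val p.1 * val p.2.
have [F FE'] := freeg_lift f.
have FE x y : F << (x, y) >> = val x * val y by rewrite FE'.
have F0 z : z \in lspan (@tensor_relations R (submodule I) (submodule J)) -> F z = 0.
  move: z; apply: lspan_ind => [|k z z' zrel zE]; first exact: linear0.
  rewrite linearP zE addr0 (_ : F z = 0) ?scaler0 //.
  case: zrel => [[x [x' [y ->]]]|[x [y [y' ->]]]|[s [x [y ->]]]|[s [x [y ->]]]].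
  - by rewrite !linearB !FE val_submodD mulrDl addrAC addrK subrr.
  - by rewrite !linearB !FE val_submodD mulrDr addrAC addrK subrr.
  - by rewrite linearB linearZ /= !FE val_submodZ !scale_fracE mulrA subrr.
  - by rewrite linearB linearZ /= !FE val_submodZ !scale_fracE mulrCA subrr.
move=> /F0; rewrite linearZ /= => /eqP; rewrite scale_fracE mulf_eq0 tofrac_eq0 (negPf r0) /=.
move=> /eqP FZ; rewrite -[RHS]FZ linear_sum; apply: eq_bigr => i _.
by rewrite FE toJK ?scaled_div // mulrC divfK.
Qed.

(** Expanding the first factor in the generators a i sends a pure tensor to a
    family in K ^ m.  The expansion is not unique, but two of them differ by a
    syzygy, so that the map is well defined and bilinear modulo the
    denominator.  It sends [gen_sum w] to the class of w. *)
Lemma gen_sum_eq0 w : (forall i, w i \in scaled_module (a i) J) ->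
  gen_sum w = 0 -> combine w \in denominator a J e.
Proof.
move=> wJ; rewrite gen_sum_pi => /pi_quotient_eq0.
have /choice[c cE] (x : submodule I) : exists c : 'I_m -> R, val x = \sum_i c i *: a i.
  by apply: lspan_rangeP; rewrite -I_gen; exact: valP.
(* The family d i a i y of the expansion d; c is one fixed choice. *)
pose cy (d : 'I_m -> R) (y : K) := combine (fun i => d i *: (a i * y)).
have [F FE'] := freeg_lift (fun p : submodule I * submodule J => cy (c p.1) (val p.2)).
have FE x y : F << (x, y) >> = cy (c x) (val y) by rewrite FE'.
have cyD (x : submodule I) d y : y \in J -> val x = \sum_i d i *: a i ->
    cy (c x) y - cy d y \in denominator a J e.
  move=> yJ xE; rewrite -combineB.
  have -> : (fun i => c x i *: (a i * y) - d i *: (a i * y)) =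
            (fun i => (c x i - d i) *: (a i * y)).
    by apply/funext => i; rewrite scalerBl.
  apply: syzygy_denominator => //.
  by under eq_bigr do rewrite scalerBl; rewrite sumrB -xE -cE subrr.
have FD z : z \in lspan (@tensor_relations R (submodule I) (submodule J)) ->
    F z \in denominator a J e.
  apply: lspan_linear => {}z.
  case=> [[x [x' [y ->]]]|[x [y [y' ->]]]|[s [x [y ->]]]|[s [x [y ->]]]].
  - rewrite !linearB !FE -addrA -opprD -combineD.
    have -> : (fun i => c x i *: (a i * val y) + c x' i *: (a i * val y)) =
              (fun i => (c x i + c x' i) *: (a i * val y)).
      by apply/funext => i; rewrite scalerDl.
    apply: cyD; first exact: valP.
    by rewrite val_submodD !cE -big_split; apply: eq_bigr => i _; rewrite scalerDl.
  - rewrite !linearB !FE (_ : cy _ _ = cy (c x) (val y) + cy (c x) (val y')).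
      by rewrite addrAC addrK subrr rpred0.
    rewrite -combineD; congr combine; apply/funext => i.
    by rewrite val_submodD mulrDr scalerDr.
  - rewrite linearB linearZ /= !FE -combineZ.
    have -> : (fun i => s *: (c x i *: (a i * val y))) =
              (fun i => (s * c x i) *: (a i * val y)).
      by apply/funext => i; rewrite scalerA.
    apply: cyD; first exact: valP.
    by rewrite val_submodZ cE scaler_sumr; apply: eq_bigr => i _; rewrite scalerA.
  - rewrite linearB linearZ /= !FE (_ : cy _ _ = s *: cy (c x) (val y)) ?subrr ?rpred0 //.
    rewrite -combineZ; congr combine; apply/funext => i.
    by rewrite val_submodZ !scale_fracE !mulrA [_ * s%:F]mulrC !mulrA.
move=> /FD; rewrite linear_sum /= => FZ.
pose y i := w i / a i.
have yJ i : y i \in J by exact: scaled_div.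
pose d i (j : 'I_m) : R := (j == i)%:R.
have -> : combine w =
    \sum_i cy (c (gen i)) (y i) - \sum_i (cy (c (gen i)) (y i) - cy (d i) (y i)).
  rewrite sumrB opprB addrC subrK -combine_sum; congr combine; apply/funext => j.
  rewrite (bigD1 j) //= /d eqxx scale1r /y mulrC divfK // big1 ?addr0 // => i.
  by rewrite eq_sym => /negPf->; rewrite scale0r.
apply: submodB; last first.
  apply: rpred_sum => i _; apply: cyD => //=.
  rewrite (bigD1 i) //= /d eqxx scale1r big1 ?addr0 // => j /negPf->.
  by rewrite scale0r.
rewrite (eq_bigr (fun i => F << (gen i, toJ (y i)) >>)) // => i _.
by rewrite FE toJK.
Qed.

Lemma toJ0 : toJ 0 = 0.
Proof. by apply: val_inj; rewrite toJK ?rpred0 // raddf0. Qed.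

Lemma gen_sum0 : gen_sum (fun=> 0) = 0.
Proof. by rewrite /gen_sum big1 // => i _; rewrite mul0r toJ0 pure0r. Qed.

Lemma gen_sum_single i (x : K) :
  gen_sum (fun l => if l == i then x else 0) = pure (gen i) (toJ (x / a i)).
Proof.
rewrite /gen_sum (bigD1 i) //= eqxx big1 ?addr0 // => l /negPf->.
by rewrite mul0r toJ0 pure0r.
Qed.

(** A generator of the denominator gives
    a i (x) p y - a j (x) q y = (p a i - q a j) (x) y = 0. *)
Lemma gen_sum_diff (p q : R) i j (y : K) : y \in J ->
    a i * p%:F = a j * q%:F ->
  exists w : 'I_m -> K, [/\ scaled_diff e (a i * p%:F * y) i j = combine w,
    forall l, w l \in scaled_module (a l) J & gen_sum w = 0].
Proof.
move=> yJ pq; set x := a i * p%:F * y.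
have single (l : 'I_m) (s : R) : x = a l * s%:F * y ->
    (forall l', (if l' == l then x else 0) \in scaled_module (a l') J) /\
    gen_sum (fun l' => if l' == l then x else 0) = s *: pure (gen l) (toJ y).
  move=> xl; have syJ : s *: y \in J by rewrite rpredZ.
  have xE : x / a l = s *: y by rewrite xl mulrC -mulrA mulKf.
  split=> [l'|].
    case: eqP => [->|_]; last exact: rpred0.
    by apply/scaled_moduleP; exists (s *: y) => //; rewrite xl scale_fracE mulrA.
  rewrite gen_sum_single -pureZr xE; congr pure; apply: val_inj.
  by rewrite val_submodZ !toJK.
have [iJ iE] := single i p erefl.
have [jJ jE] := single j q (congr1 ( *%R^~ y) pq).
exists (fun l => -1 *: (if l == j then x else 0) + (if l == i then x else 0)); split.
- by rewrite scaled_diffE; congr combine; apply/funext => l; rewrite scaleN1r addrC.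
- by move=> l; apply: rpredD; [apply: rpredZ; exact: jJ|exact: iJ].
rewrite gen_sum_linear // iE jE scaleN1r addrC; apply/eqP; rewrite subr_eq0 -!pureZl.
apply/eqP; congr pure; apply: val_inj; rewrite !val_submodZ /= !scale_fracE.
by rewrite mulrC pq mulrC.
Qed.

Lemma denominator_gen_sum v : v \in denominator a J e -> exists w : 'I_m -> K,
  [/\ v = combine w, forall i, w i \in scaled_module (a i) J & gen_sum w = 0].
Proof.
move: v; apply: lspan_ind => [|r _ _ [i [j [c [_ cP ->]]]] [w' [-> w'J w'0]]].
  by exists (fun=> 0); split=> [|i|]; [rewrite combine0|exact: rpred0|exact: gen_sum0].
suff [w [wE wJ w0]] : exists w : 'I_m -> K, [/\ scaled_diff e c i j = combine w,
    forall i, w i \in scaled_module (a i) J & gen_sum w = 0].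
  exists (fun l => r *: w l + w' l); split=> [|l|].
  - by rewrite combineD combineZ wE.
  - by apply: rpredD; [apply: rpredZ; exact: wJ|exact: w'J].
  - by rewrite gen_sum_linear // w0 w'0 scaler0 addr0.
move: c cP; apply: lspan_ind => [|s _ c [u [[p _ uE] [q _ uE']] [y yJ <-]] [w [wE wJ w0]]].
  exists (fun=> 0); split=> [|l|]; [|exact: rpred0|exact: gen_sum0].
  by rewrite scaled_diffE; congr combine; apply/funext => l; rewrite !if_same subrr.
have [w1 [w1E w1J w10]] := gen_sum_diff yJ (etrans uE (esym uE')).
exists (fun l => s *: w1 l + w l); split=> [|l|].
- rewrite combineD combineZ -wE -w1E uE; apply/ffunP => l; rewrite !ffunE.
  by rewrite mulrDl !scale_fracE mulrA.
- by apply: rpredD; [apply: rpredZ; exact: w1J|exact: wJ].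
- by rewrite gen_sum_linear // w0 w10 scaler0 addr0.
Qed.

(** Send the class of [combine w] to [gen_sum w]; the kernel is the denominator
    by [gen_sum_eq0] and [denominator_gen_sum]. *)
Lemma torsion_presentation :
  lmod_isomorphic (submodule (torsion TIJ))
    (subquotient (numerator a J e) (denominator a J e)).
Proof.
pose G0 (v : submodule (numerator a J e)) : TIJ := gen_sum (coord (val v)).
have G0P (v : submodule (numerator a J e)) : exists w : 'I_m -> K,
    [/\ val v = combine w, forall i, w i \in scaled_module (a i) J,
        \sum_i w i = 0 & coord (val v) = w].
  have /numeratorP[w [vE wJ w0]] := valP v.
  by exists w; split=> //; rewrite vE combineK.
have Glin : linear G0.
  move=> r v v'; have [[w [vE wJ _ cv]] [w' [v'E w'J _ cv']]] := (G0P v, G0P v').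
  rewrite -gen_sum_linear /G0 ?cv ?cv' //; congr gen_sum.
  by rewrite val_submodD val_submodZ vE v'E -combineZ -combineD combineK.
pose GL := GRing.isLinear.Build R (submodule (numerator a J e)) TIJ *:%R G0 Glin.
pose G : {linear submodule (numerator a J e) -> TIJ} := HB.pack G0 GL.
apply: (subquotient_iso (G := G)) => [v|v|s sT].
- by have [w [_ wJ w0 cv]] := G0P v; rewrite /= /G0 cv; exact: gen_sum_torsion.
- have [w [vE wJ w0 cv]] := G0P v; rewrite /= /G0 cv vE.
  split; first exact: gen_sum_eq0.
  by move=> /denominator_gen_sum[w' [/(can_inj combineK)-> _]].
have [w [wJ sE]] := gen_sum_onto s.
have w0 : \sum_i w i = 0 by apply: torsion_sum => //; rewrite -sE.
have vN : combine w \in numerator a J e by apply/numeratorP; exists w.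
by exists (exist _ (combine w) vN); rewrite /= /G0 /= combineK.
Qed.

End Presentation.

Theorem theorem1p3 (R : idomainType) (mon : set {fraction R})
  (setting : graded_case mon \/ local_case mon)
  (m : nat) (a : 'I_m -> {fraction R}) (I J : submodClosed {fraction R})
  (a_mon : forall i, mon (a i)) (I_gen : I =i lspan (range a))
  (I_mon : monomial_fractional_ideal mon I)
  (J_mon : monomial_fractional_ideal mon J)
  (e : 'I_m -> {ffun 'I_m -> R^o}) (e_basis : module_basis e) :
  lmod_isomorphic
    (submodule (torsion (tensor (submodule I) (submodule J))))
    (subquotient (numerator a J e) (denominator a J e)).
Proof.
have [mon_neq0 monM mon_exact] : exact_monomials mon.
  case: setting => [[k [n [phi [phi_graded ->]]]]|loc].
    exact: graded_exact_monomials.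
  exact: local_exact_monomials.
have a_neq0 i : a i != 0 by exact: mon_neq0.
apply: torsion_presentation => //; apply: mon_exact => i.
  apply: (scaled_monomial_ideal (b := fun _ : 'I_1 => 1)) => [//||x|_].
  - by exists 1; [exact: mem_lspan|exact: oner_neq0].
  - by rewrite /scalars (_ : range _ = [set 1]) //; apply/seteqP; split=> [_ [_ _ <-]|_ ->] //;
      exists ord0.
  - by rewrite mulr1.
have [[_ J_neq0] [h [b [bmon JE]]]] := J_mon.
by apply: scaled_monomial_ideal JE _ => // j; apply: monM.
Qed.
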